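(* There exist a universal constant $C>0$ and a circuit augmentation algorithm, in which every augmenting direction is obtained from a call to the Ratio-Circuit oracle, with the following guarantee. Given any $n\ge2$, any bounded linear program $\min\{\langle c,x\rangle : Ax=b,\ x\ge \mathbf 0\}$ (feasible, finite optimal value, max central path $x^{\mathfrak m}$ well defined) with $A\in\mathbb{R}^{m\times n}$, $\mathrm{rk}(A)=m$, $b\in\mathbb{R}^m$, $c\in\mathbb{R}^n$, and any feasible point $x$ with optimality gap $g\ge 0$, the algorithm started at $x$ returns an optimal solution using at most $$C\,n^2\log(n)\sum_{i=1}^n \mathrm{SLC}_{1/2}(x^{\mathfrak m}_i,g)$$ Ratio-Circuit augmentation steps.
   Context: The input of the algorithm is only $(A,b,c)$ and the feasible point $x$; in particular it has no access to the max central path, the optimal value or the gap $g$. Between augmentation steps it may make further calls to the Ratio-Circuit oracle and perform exact real linear-algebraic computations (including singular value decompositions). Notation for the LP with feasible region $P=\{x\in\mathbb{R}^n:Ax=b,\ x\ge\mathbf 0\}$ and optimal value $v^*$: the optimality gap of $x\in P$ is $\langle c,x\rangle-v^*$. Circuits: an elementary vector of $A$ is a vector $h\in\ker(A)\setminus\{\mathbf 0\}$ of inclusion-minimal support among nonzero vectors of $\ker(A)$; $\mathcal E(A)$ is the set of elementary vectors. A circuit augmentation algorithm maintains a point $x^{(t)}\in P$; in each iteration it computes some $h\in\mathcal E(A)$ and updates $x^{(t+1)}=x^{(t)}+\alpha h$, where $\alpha$ is the maximal step size with $x^{(t)}+\alpha h\in P$ (an augmentation step). Ratio-Circuit oracle: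 the input is $A\in\mathbb{R}^{m\times n}$, costs $u\in\mathbb{R}^n$ and weights $v,w\in(\mathbb{R}_{\ge0}\cup\{\infty\})^n$. The output is a basic optimal solution $z$ to $\min\{\langle u,z\rangle: Az=\mathbf 0,\ \langle v,z^+\rangle+\langle w,z^-\rangle\le1\}$, where $(z^+)_i=\max\{z_i,0\}$, $(z^-)_i=\max\{-z_i,0\}$, and $\infty\cdot0=0$, together with an optimal solution $(y,s,\lambda)$ to the dual program $\max\{-\lambda: A^\top y+s=u,\ -\lambda v\le s\le\lambda w\}$. Here a basic optimal solution means $z=z^+-z^-$ for a basic optimal solution $(z^+,z^-)$ of the LP $\min\{\langle u,z^+\rangle-\langle u,z^-\rangle: Az^+-Az^-=\mathbf 0,\ \langle v,z^+\rangle+\langle w,z^-\rangle\le1,\ z^+,z^-\ge\mathbf 0\}$. When bounded, such a solution is $\mathbf 0$ or an elementary vector of $A$. Max central path: for $g\ge0$ let $P_g=\{x\in P:\langle c,x\rangle\le v^*+g\}$, assumed bounded, and $x^{\mathfrak m}_i(g)=\max\{x_i:x\in P_g\}$ for $i\in[n]$. Straight line complexity: for $\phi:\mathbb{R}_{\ge0}\to\mathbb{R}_{\ge0}$, $\eta\in(0,1]$ and $g\ge0$, $\mathrm{SLC}_\eta(\phi,g)$ is the minimum number of pieces of a continuous piecewise linear function $\psi:[0,g]\to\mathbb{R}_{\ge0}$ with $\eta\phi\le\psi\le\phi$ on $[0,g]$. *)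

(* Defs.v *)
From HB Require Import structures.
From mathcomp Require Import all_boot all_order all_algebra.
From mathcomp Require Import all_classical all_reals all_analysis.

Set Implicit Arguments.
Unset Strict Implicit.
Unset Printing Implicit Defensive.

Import Order.TTheory GRing.Theory Num.Theory.
Import numFieldNormedType.Exports.

Local Open Scope classical_set_scope.
Local Open Scope ring_scope.

(** * Linear programs *)

Section LinearProgram.
Context {R : realType}.

Definition dot n (u x : 'cV[R]_n) : R := \sum_i u i 0 * x i 0.

Definition polyhedron m n (A : 'M[R]_(m, n)) (b : 'cV[R]_m) : set 'cV[R]_n :=
  [set x | A *m x = b /\ forall i, 0 <= x i 0].

Definition lp_values m n (A : 'M[R]_(m, n)) (b : 'cV[R]_m) (c : 'cV[R]_n) :
  set R := [set dot c x | x in polyhedron A b].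

Definition opt_value m n (A : 'M[R]_(m, n)) (b : 'cV[R]_m) (c : 'cV[R]_n) : R :=
  inf (lp_values A b c).

Definition lp_optimal m n (A : 'M[R]_(m, n)) (b : 'cV[R]_m) (c : 'cV[R]_n)
    (x : 'cV[R]_n) : Prop :=
  polyhedron A b x /\ forall y, polyhedron A b y -> dot c x <= dot c y.

Definition opt_gap m n (A : 'M[R]_(m, n)) (b : 'cV[R]_m) (c x : 'cV[R]_n) : R :=
  dot c x - opt_value A b c.

(** ** Max central path *)

Definition sublevel m n (A : 'M[R]_(m, n)) (b : 'cV[R]_m) (c : 'cV[R]_n)
    (g : R) : set 'cV[R]_n :=
  [set x | polyhedron A b x /\ dot c x <= opt_value A b c + g].

Definition bounded_vectors n (S : set 'cV[R]_n) : Prop :=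
  exists M : R, forall x, S x -> forall i, `|x i 0| <= M.

(* When [sublevel A b c g] is nonempty and bounded it is compact, so that this
   supremum is a maximum. *)
Definition max_central_path m n (A : 'M[R]_(m, n)) (b : 'cV[R]_m)
    (c : 'cV[R]_n) (i : 'I_n) (g : R) : R :=
  sup [set x i 0 | x in sublevel A b c g].

(** ** Straight line complexity *)

(* The k >= 1 pieces are closed intervals [t_j, t_(j+1)]; weakly increasing
   breakpoints do not change the minimum number of pieces when g > 0, and give
   the degenerate interval [0, 0] one piece. *)
Definition piecewise_linear (psi : R -> R) (g : R) (k : nat) : Prop :=
  (0 < k)%N /\ {within `[0, g], continuous psi} /\
  exists t : nat -> R,
    [/\ t 0%N = 0, t k = g &
        forall j, (j < k)%N -> t j <= t j.+1 /\
          exists a d : R, forall x, t j <= x <= t j.+1 -> psi x = a * x + d].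

Definition SLC (eta : R) (phi : R -> R) (g : R) : \bar R :=
  ereal_inf [set k%:R%:E | k in
    [set k | exists psi : R -> R, piecewise_linear psi g k /\
       forall x, 0 <= x <= g ->
         [/\ 0 <= psi x, eta * phi x <= psi x & psi x <= phi x]]].

(** * Circuits and augmentation *)

Definition supp n (x : 'cV[R]_n) : {set 'I_n} := [set i | x i 0 != 0]%SET.

Definition elementary m n (A : 'M[R]_(m, n)) (h : 'cV[R]_n) : Prop :=
  [/\ A *m h = 0, h != 0 &
      forall h', A *m h' = 0 -> h' != 0 -> ~~ (supp h' \proper supp h)].

Definition max_step m n (A : 'M[R]_(m, n)) (b : 'cV[R]_m) (x h : 'cV[R]_n)
    (alpha : R) : Prop :=
  polyhedron A b (x + alpha *: h) /\
  forall beta, polyhedron A b (x + beta *: h) -> beta <= alpha.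

(** * The Ratio-Circuit problem *)

(* Recall that [+oo * 0 = 0] in [\bar R]. *)
Definition weighted n (v w : 'I_n -> \bar R) (p q : 'cV[R]_n) : \bar R :=
  (\sum_i v i * (p i 0)%:E + \sum_i w i * (q i 0)%:E)%E.

Definition pos_part n (z : 'cV[R]_n) : 'cV[R]_n := \col_i Num.max (z i 0) 0.
Definition neg_part n (z : 'cV[R]_n) : 'cV[R]_n := \col_i Num.max (- z i 0) 0.

Definition ratio_feasible m n (A : 'M[R]_(m, n)) (v w : 'I_n -> \bar R)
    (z : 'cV[R]_n) : Prop :=
  A *m z = 0 /\ (weighted v w (pos_part z) (neg_part z) <= 1)%E.

Definition ratio_bounded m n (A : 'M[R]_(m, n)) (u : 'cV[R]_n)
    (v w : 'I_n -> \bar R) : Prop :=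
  exists L : R, forall z, ratio_feasible A v w z -> L <= dot u z.

Definition split_feasible m n (A : 'M[R]_(m, n)) (v w : 'I_n -> \bar R)
    (p q : 'cV[R]_n) : Prop :=
  [/\ A *m p - A *m q = 0, (weighted v w p q <= 1)%E &
      forall i, 0 <= p i 0 /\ 0 <= q i 0].

(* Constraint matrix of the split program in equality form, with one slack
   variable.  A variable of infinite weight vanishes at every feasible point,
   so the real number [fine +oo] in its column is irrelevant to [basic]. *)
Definition split_matrix m n (A : 'M[R]_(m, n)) (v w : 'I_n -> \bar R) :
    'M[R]_(m + 1, (n + n) + 1) :=
  block_mx (row_mx A (- A)) 0
           (row_mx (\row_i fine (v i)) (\row_i fine (w i))) 1%:M.

Definition split_point n (v w : 'I_n -> \bar R) (p q : 'cV[R]_n) :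
    'cV[R]_((n + n) + 1) :=
  col_mx (col_mx p q) (1 - fine (weighted v w p q))%:M.

(* The columns of M indexed by the support of x are linearly independent. *)
Definition basic k l (M : 'M[R]_(k, l)) (x : 'cV[R]_l) : Prop :=
  forall d : 'cV[R]_l, M *m d = 0 -> supp d \subset supp x -> d = 0.

Definition ratio_basic_optimal m n (A : 'M[R]_(m, n)) (u : 'cV[R]_n)
    (v w : 'I_n -> \bar R) (z : 'cV[R]_n) : Prop :=
  exists p q : 'cV[R]_n,
    [/\ z = p - q,
        split_feasible A v w p q,
        basic (split_matrix A v w) (split_point v w p q) &
        forall p' q', split_feasible A v w p' q' ->
          dot u p - dot u q <= dot u p' - dot u q'].

(* The multiplier of the inequality is nonnegative, and an infinite weight
   means that the corresponding primal variable is absent, hence imposes no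
   dual constraint, also when [lambda = 0]. *)
Definition ratio_dual_feasible m n (A : 'M[R]_(m, n)) (u : 'cV[R]_n)
    (v w : 'I_n -> \bar R) (y : 'cV[R]_m) (s : 'cV[R]_n) (lambda : R) : Prop :=
  [/\ A^T *m y + s = u, 0 <= lambda &
      forall i, (v i \is a fin_num -> - (lambda * fine (v i)) <= s i 0) /\
                (w i \is a fin_num -> s i 0 <= lambda * fine (w i))].

Definition ratio_dual_optimal m n (A : 'M[R]_(m, n)) (u : 'cV[R]_n)
    (v w : 'I_n -> \bar R) (y : 'cV[R]_m) (s : 'cV[R]_n) (lambda : R) : Prop :=
  ratio_dual_feasible A u v w y s lambda /\
  forall y' s' lambda', ratio_dual_feasible A u v w y' s' lambda' ->
    - lambda' <= - lambda.

(** * Singular value decomposition *)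

Definition is_svd p q (M : 'M[R]_(p, q)) (U : 'M[R]_p) (D : 'M[R]_(p, q))
    (V : 'M[R]_q) : Prop :=
  [/\ M = U *m D *m V^T, U^T *m U = 1%:M, V^T *m V = 1%:M,
      forall i j, 0 <= D i j /\ ((i : nat) <> j -> D i j = 0) &
      forall (i i' : 'I_p) (j j' : 'I_q),
        (i : nat) = j -> (i' : nat) = j' -> (i <= i')%N -> D i' j' <= D i j].

End LinearProgram.

(** * Circuit augmentation algorithms

   An algorithm is a program for a real random access machine.  It is a finite
   piece of syntax, which mentions neither the dimensions nor the data of the
   instance.  The machine has natural number registers, and arrays of real
   numbers with two natural number indices.  Real numbers can be
   combined by exact arithmetic and compared, but there is no conversion from
   real to natural numbers. *)

Inductive nat_expr :=
| NConst of nat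
| NVar of nat
| NRows
| NCols
| NAdd of nat_expr & nat_expr
| NSub of nat_expr & nat_expr
| NMul of nat_expr & nat_expr.

(* [RCur e] is coordinate [e] of the current feasible point. *)
Inductive real_expr :=
| RNat of nat_expr
| RCell of nat & nat_expr & nat_expr
| RCur of nat_expr
| RAdd of real_expr & real_expr
| RSub of real_expr & real_expr
| RMul of real_expr & real_expr
| RDiv of real_expr & real_expr.

Inductive test :=
| TLeN of nat_expr & nat_expr
| TLeR of real_expr & real_expr
| TNot of test
| TAnd of test & test.

(* [SVD a p q U D V] decomposes the p x q upper left corner of array [a].
   [Ratio u v w z y s l] queries the oracle for the constraint matrix of the
   instance and stores its answer in the arrays z, y, s, l.
   [Augment h] is an augmentation step in the direction stored in [h]. *)
Inductive program :=
| Skip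
| SetN of nat & nat_expr
| SetR of nat & nat_expr & nat_expr & real_expr
| Seq of program & program
| If of test & program & program
| While of test & program
| SVD of nat & nat_expr & nat_expr & nat & nat & nat
| Ratio of nat & nat & nat & nat & nat & nat & nat
| Augment of nat.

Section Semantics.
Context {R : realType}.

Definition array := nat -> nat -> R.

Definition matrix_of p q (a : array) : 'M[R]_(p, q) := \matrix_(i, j) a i j.

Definition array_of p q (M : 'M[R]_(p, q)) : array := fun i j =>
  if insub i is Some i' then if insub j is Some j' then M i' j' else 0 else 0.

(* Entry i of a weight vector is stored in row i: it is infinite if column 1
   is nonzero, and otherwise it is the real number in column 0. *)
Definition weights_of n (a : array) : 'I_n -> \bar R := fun i =>
  if a i 1%N == 0 then (a i 0%N)%:E else +oo%E.

(* [returned] lists the primal vectors returned by the oracle so far, and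
   [steps] counts the augmentation steps; programs cannot write to [current],
   [returned] or [steps] except through [Ratio] and [Augment]. *)
Record state n := State {
  nats : nat -> nat;
  arrays : nat -> array;
  current : 'cV[R]_n;
  returned : seq 'cV[R]_n;
  steps : nat }.

Definition upd (T : Type) (f : nat -> T) (k : nat) (x : T) : nat -> T :=
  fun k' => if k' == k then x else f k'.

Definition set_nat n (st : state n) (k e : nat) : state n :=
  State (upd (nats st) k e) (arrays st) (current st) (returned st) (steps st).

Definition set_array n (st : state n) (k : nat) (a : array) : state n :=
  State (nats st) (upd (arrays st) k a) (current st) (returned st) (steps st).

Definition log_direction n (st : state n) (z : 'cV[R]_n) : state n :=
  State (nats st) (arrays st) (current st) (z :: returned st) (steps st).

Definition augmented n (st : state n) (x : 'cV[R]_n) : state n :=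
  State (nats st) (arrays st) x (returned st) (steps st).+1.

Fixpoint eval_nat (m n : nat) (st : state n) (e : nat_expr) : nat :=
  match e with
  | NConst k => k
  | NVar k => nats st k
  | NRows => m
  | NCols => n
  | NAdd e1 e2 => eval_nat m st e1 + eval_nat m st e2
  | NSub e1 e2 => eval_nat m st e1 - eval_nat m st e2
  | NMul e1 e2 => eval_nat m st e1 * eval_nat m st e2
  end%N.

Fixpoint eval_real (m n : nat) (st : state n) (e : real_expr) : R :=
  match e with
  | RNat e1 => (eval_nat m st e1)%:R
  | RCell k e1 e2 => arrays st k (eval_nat m st e1) (eval_nat m st e2)
  | RCur e1 => array_of (current st) (eval_nat m st e1) 0%N
  | RAdd e1 e2 => eval_real m st e1 + eval_real m st e2
  | RSub e1 e2 => eval_real m st e1 - eval_real m st e2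
  | RMul e1 e2 => eval_real m st e1 * eval_real m st e2
  | RDiv e1 e2 => eval_real m st e1 / eval_real m st e2
  end.

Fixpoint eval_test (m n : nat) (st : state n) (t : test) : bool :=
  match t with
  | TLeN e1 e2 => (eval_nat m st e1 <= eval_nat m st e2)%N
  | TLeR e1 e2 => eval_real m st e1 <= eval_real m st e2
  | TNot t1 => ~~ eval_test m st t1
  | TAnd t1 t2 => eval_test m st t1 && eval_test m st t2
  end.

(* Total correctness: [ensures A b prog st Q] says that, for every choice of
   the answers of the oracle and of the singular value decompositions, running
   [prog] from [st] terminates without error in a state satisfying [Q].
   - [Ratio] is an error if a weight is negative.  The answer is arbitrary if
     the Ratio-Circuit program is unbounded; otherwise, it consists of a basic
     optimal and a dual optimal solution.
   - [Augment] is an error unless the direction is an elementary vector that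
     was returned by the oracle, and along which there is a maximal step. *)
Inductive ensures m n (A : 'M[R]_(m, n)) (b : 'cV[R]_m) :
    program -> state n -> (state n -> Prop) -> Prop :=
| EnsSkip st (Q : state n -> Prop) : Q st -> ensures A b Skip st Q
| EnsSetN k e st (Q : state n -> Prop) :
    Q (set_nat st k (eval_nat m st e)) -> ensures A b (SetN k e) st Q
| EnsSetR k e1 e2 e st (Q : state n -> Prop) :
    (let row := eval_nat m st e1 in
     Q (set_array st k (upd (arrays st k) row
          (upd (arrays st k row) (eval_nat m st e2) (eval_real m st e))))) ->
    ensures A b (SetR k e1 e2 e) st Q
| EnsSeq p1 p2 st (Q1 Q : state n -> Prop) :
    ensures A b p1 st Q1 ->
    (forall st1, Q1 st1 -> ensures A b p2 st1 Q) ->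
    ensures A b (Seq p1 p2) st Q
| EnsIf t p1 p2 st (Q : state n -> Prop) :
    ensures A b (if eval_test m st t then p1 else p2) st Q ->
    ensures A b (If t p1 p2) st Q
| EnsWhileStop t p st (Q : state n -> Prop) :
    eval_test m st t = false -> Q st -> ensures A b (While t p) st Q
| EnsWhileLoop t p st (Q1 Q : state n -> Prop) :
    eval_test m st t = true -> ensures A b p st Q1 ->
    (forall st1, Q1 st1 -> ensures A b (While t p) st1 Q) ->
    ensures A b (While t p) st Q
| EnsSVD a e1 e2 ku kd kv st (Q : state n -> Prop) :
    (let p := eval_nat m st e1 in
     let q := eval_nat m st e2 in
     forall (U : 'M[R]_p) (D : 'M[R]_(p, q)) (V : 'M[R]_q),
       is_svd (matrix_of p q (arrays st a)) U D V ->
       Q (set_array (set_array (set_array st ku (array_of U))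
            kd (array_of D)) kv (array_of V))) ->
    ensures A b (SVD a e1 e2 ku kd kv) st Q
| EnsRatio ku kv kw kz ky ks kl st (Q : state n -> Prop) :
    (let u := matrix_of n 1 (arrays st ku) in
     let v := @weights_of n (arrays st kv) in
     let w := @weights_of n (arrays st kw) in
     (forall i, (0 <= v i)%E /\ (0 <= w i)%E) /\
     forall (z : 'cV[R]_n) (y : 'cV[R]_m) (s : 'cV[R]_n) (lambda : R),
       (ratio_bounded A u v w ->
          ratio_basic_optimal A u v w z /\
          ratio_dual_optimal A u v w y s lambda) ->
       Q (log_direction
            (set_array (set_array (set_array (set_array st kz (array_of z))
               ky (array_of y)) ks (array_of s))
               kl (array_of (const_mx lambda : 'M[R]_1))) z)) ->
    ensures A b (Ratio ku kv kw kz ky ks kl) st Q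
| EnsAugment k st (Q : state n -> Prop) alpha :
    (let h := matrix_of n 1 (arrays st k) in
     [/\ h \in returned st, elementary A h,
         max_step A b (current st) h alpha &
         Q (augmented st (current st + alpha *: h))]) ->
    ensures A b (Augment k) st Q.

(* The input A, b, c is stored in the arrays 0, 1, 2. *)
Definition initial_state m n (A : 'M[R]_(m, n)) (b : 'cV[R]_m)
    (c x : 'cV[R]_n) : state n :=
  State (fun=> 0%N)
    (upd (upd (upd (fun _ _ _ => 0) 0 (array_of A)) 1 (array_of b))
       2 (array_of c))
    x [::] 0.

End Semantics.

(* Main.v *)
(** Every straight line complexity is at least 1, so it suffices to reach an
optimal point in at most 41 n^3 augmentation steps.

Such a circuit walk always exists.  Fix an optimal point y and let S be the set
of coordinates where the current point exceeds 2 y.  Following for O(n^2) steps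
the best circuit in a conformal decomposition of y - x shrinks the sum of the
coordinates in S by a factor exponential in n, while every other coordinate
stays within a polynomial factor of y.  So a tiny multiple of y - x0, where x0
is the first of these points, is enough to bring the coordinate of S that shrank
most to 0, before any coordinate outside of S gets there.  Hence S loses an
element, and after n such phases the support of x lies in the support of y,
which makes x optimal.

The algorithm enumerates the circuit walks by length and simulates them without
moving, until one of them ends in a point that the oracle certifies as optimal;
only that walk is executed.  A walk is a sequence of sign patterns written in
base 3.  An answer of the oracle is followed only if it has all the signs of the
pattern, which determines the circuit up to scaling, so that the execution
repeats the simulation although the oracle may answer differently. *)

Require Import Defs.
From mathcomp Require Import all_boot all_order all_algebra.
From mathcomp Require Import all_classical all_reals all_analysis.
From mathcomp Require Import ring lra zify.

Set Implicit Arguments.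
Unset Strict Implicit.
Unset Printing Implicit Defensive.

Import Order.TTheory GRing.Theory Num.Theory.
Import numFieldNormedType.Exports.

Local Open Scope classical_set_scope.
Local Open Scope ring_scope.

(** * Conformal circuits and maximal steps *)

Section Circuits.
Context {R : realType} {m n : nat}.
Implicit Types (A : 'M[R]_(m, n)) (b : 'cV[R]_m) (u x y p h : 'cV[R]_n).

Lemma dotD u x y : dot u (x + y) = dot u x + dot u y.
Proof.
by rewrite /dot -big_split; apply: eq_bigr => i _; rewrite mxE mulrDr.
Qed.

Lemma dotZ u a x : dot u (a *: x) = a * dot u x.
Proof.
by rewrite /dot mulr_sumr; apply: eq_bigr => i _; rewrite mxE mulrCA.
Qed.

Lemma dotN u x : dot u (- x) = - dot u x.
Proof. by rewrite -scaleN1r dotZ mulN1r. Qed.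

Lemma dotB u x y : dot u (x - y) = dot u x - dot u y.
Proof. by rewrite dotD dotN. Qed.

Lemma dot0 u : dot u 0 = 0.
Proof. by rewrite -(scale0r 0) dotZ mul0r. Qed.

Lemma in_supp x i : (i \in supp x) = (x i 0 != 0).
Proof. by rewrite inE. Qed.

Lemma supp_eq0 x : (supp x == finset.set0) = (x == 0).
Proof.
apply/eqP/eqP => [x0|->]; last by apply/setP => i; rewrite !inE mxE eqxx.
apply/colP => i; apply/eqP; rewrite mxE; apply/negPn.
by rewrite -in_supp x0 inE.
Qed.

Lemma neq0_coord x : x != 0 -> exists i, x i 0 != 0.
Proof.
by rewrite -supp_eq0 => /set0Pn[i]; rewrite in_supp; exists i.
Qed.

Lemma supp_proper x y i : (forall j, y j 0 = 0 -> x j 0 = 0) ->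
  y i 0 != 0 -> x i 0 = 0 -> supp x \proper supp y.
Proof.
move=> xy yi xi; apply/properP; split.
  by apply/fintype.subsetP => j; rewrite !in_supp;
    apply: contraNN => /eqP/xy ->.
by exists i; rewrite in_supp // xi eqxx.
Qed.

Lemma suppZ a x : a != 0 -> supp (a *: x) = supp x.
Proof. by move=> a0; apply/setP => i;
  rewrite !in_supp mxE mulf_eq0 negb_or a0. Qed.

Lemma elementaryZ A h a : a != 0 -> elementary A h -> elementary A (a *: h).
Proof.
move=> a0 [Ah h0 hmin]; split; rewrite ?suppZ //.
  by rewrite -scalemxAr Ah scaler0.
by rewrite scaler_eq0 negb_or a0.
Qed.

(** Subtracting the multiple of [h] that agrees with [z] at [i] leaves a kernel vector of strictly
    smaller support, which must vanish by minimality. *)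
Lemma elementary_multiple A h z i : elementary A h -> A *m z = 0 ->
  supp z \subset supp h -> h i 0 != 0 -> z = (z i 0 / h i 0) *: h.
Proof.
move=> [Ah h0 hmin] Az /fintype.subsetP zh hi.
apply/eqP; rewrite -subr_eq0; apply/negPn/negP => d0.
have Ad : A *m (z - (z i 0 / h i 0) *: h) = 0.
  by rewrite mulmxBr -scalemxAr Ah Az scaler0 subr0.
move/negP: (hmin _ Ad d0); apply; apply: (@supp_proper _ _ i) => // [j hj|];
  rewrite !mxE; last by field.
have /negPn/eqP -> : ~~ (z j 0 != 0).
  by rewrite -in_supp; apply/negP => /zh; rewrite in_supp hj eqxx.
by rewrite hj mulr0 subr0.
Qed.

Definition conformal h p :=
  forall i, 0 <= h i 0 <= p i 0 \/ p i 0 <= h i 0 <= 0.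

Lemma conformal_trans q h p : conformal h q -> conformal q p -> conformal h p.
Proof. by move=> hq qp i; case: (hq i); case: (qp i); lra. Qed.

Definition same_signs h p :=
  forall i, (0 < h i 0 -> 0 < p i 0) /\ (h i 0 < 0 -> p i 0 < 0).

(** Induction on the support. If [p] is not elementary, a kernel vector [h'] of smaller support is
    subtracted at the smallest positive ratio: a coordinate of [p] cancels before any sign can flip.
    The remainder is nonzero because [h'] vanishes somewhere on the support of [p]. *)
Lemma same_signs_elementary A p : A *m p = 0 -> p != 0 ->
  exists2 h, elementary A h & same_signs h p.
Proof.
move: {2}#|supp p|.+1 (ltnSn #|supp p|) => k.
elim: k p => // k IH p pk Ap p0.
have [[h' [Ah' h'0 h'p]]|pmin] := pselect (exists h', [/\ A *m h' = 0, h' != 0 &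
    supp h' \proper supp p]); last first.
  exists p => //; split => // h' Ah' h'0; apply/negP => h'p; apply: pmin.
  by exists h'.
(* Up to replacing [h'] by its opposite, some coordinate has the sign of [p], so that the minimum
   ratio is taken over a nonempty set. *)
wlog [i0 h'i0] : h' Ah' h'0 h'p / exists i, 0 < h' i 0 * p i 0.
  move=> IHh; have [i h'i] := neq0_coord h'0.
  have pi : p i 0 != 0.
    by move/properP: h'p => [/fintype.subsetP/(_ i)];
      rewrite !in_supp => /(_ h'i).
  have : h' i 0 * p i 0 != 0 by rewrite mulf_neq0.
  rewrite neq_lt => /orP[lt0|gt0]; last by apply: (IHh h') => //; exists i.
  apply: (IHh (- h')); rewrite ?mulmxN ?Ah' ?oppr0 ?oppr_eq0 //.
    by rewrite -scaleN1r suppZ // oppr_eq0 oner_eq0.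
  by exists i; rewrite mxE mulNr oppr_gt0.
have [i h'pi tmin] := @arg_minP _ _ _ i0 (fun i => 0 < h' i 0 * p i 0)
  (fun i => p i 0 / h' i 0) h'i0.
set t := p i 0 / h' i 0 in tmin *.
have h'i : h' i 0 != 0 by apply: contraTneq h'pi => ->; rewrite mul0r ltxx.
have t0 : 0 < t.
  have -> : t = h' i 0 * p i 0 / (h' i 0) ^+ 2 by rewrite /t; field.
  by rewrite divr_gt0 // exprn_even_gt0.
pose q := p - t *: h'.
have qE j : q j 0 = p j 0 - t * h' j 0 by rewrite !mxE.
have h'z j : p j 0 = 0 -> h' j 0 = 0.
  move/properP: h'p => [/fintype.subsetP/(_ j) + _].
  by rewrite !in_supp => hj pj; apply/eqP/negPn/negP => /hj; rewrite pj eqxx.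
have qp : same_signs q p.
  move=> j; rewrite qE.
  have [hp|hp] := ltP 0 (h' j 0 * p j 0); last first.
    split=> qj; rewrite ltNge; apply/negP => pj.
      have hj : h' j 0 < 0 by nra.
      have pj0 : p j 0 = 0 by nra.
      by have := h'z _ pj0; lra.
    have hj : 0 < h' j 0 by nra.
    have pj0 : p j 0 = 0 by nra.
    by have := h'z _ pj0; lra.
  have := tmin j hp; have [hj|hj|hj] := ltgtP (h' j 0) 0.
  - have pj : p j 0 < 0 by rewrite nmulr_rgt0 in hp.
    by rewrite ler_ndivlMr // => ?; split=> ?; lra.
  - have pj : 0 < p j 0 by rewrite pmulr_rgt0 in hp.
    by rewrite ler_pdivlMr // => ?; split=> ?; lra.
  - by rewrite hj mul0r ltxx in hp.
have [|||h hE hq] := IH q.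
- suff: (#|supp q| < #|supp p|)%N by lia.
  apply/proper_card/(@supp_proper _ _ i) => [j pj||].
  + by rewrite qE pj h'z // mulr0 subr0.
  + by apply: contraTneq h'pi => ->; rewrite mulr0 ltxx.
  + by rewrite qE /t; field.
- by rewrite mulmxBr -scalemxAr Ap Ah' scaler0 subr0.
- move/properP: h'p => [_ [j]]; rewrite !in_supp => pj /negPn/eqP h'j.
  by apply: contraNneq pj => q0; move: (qE j);
    rewrite q0 h'j mxE mulr0 subr0 => <-.
by exists h => // j; have [] := hq j; have [] := qp j; tauto.
Qed.

(** A circuit with compatible signs is stretched until it first meets [p]; the coordinate where it
    does disappears from [p - h]. *)
Lemma conformal_elementary A p : A *m p = 0 -> p != 0 ->
  exists h, [/\ elementary A h, conformal h p & supp (p - h) \proper supp p].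
Proof.
move=> Ap p0; have [h hE hp] := same_signs_elementary Ap p0.
have [_ h0 _] := hE.
have [i0 hi0] := neq0_coord h0.
have [i hi tmin] := @arg_minP _ _ _ i0 (fun i => h i 0 != 0)
  (fun i => p i 0 / h i 0) hi0.
set t := p i 0 / h i 0 in tmin *.
have t0 : 0 < t.
  move: hi; rewrite neq_lt => /orP[] hi; have [hp1 hp2] := hp i.
    by rewrite /t -divrNN divr_gt0 // oppr_gt0 // hp2.
  by rewrite divr_gt0 // hp1.
have tE : t * h i 0 = p i 0 by rewrite /t; field.
exists (t *: h); split; first by apply: elementaryZ => //; rewrite gt_eqF.
- move=> j; rewrite mxE; have [hp1 hp2] := hp j.
  have [hj|hj|hj] := ltgtP (h j 0) 0.
  + by have := tmin j; rewrite lt_eqF // ler_ndivlMr // => /(_ isT); right; nra.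
  + by have := tmin j; rewrite gt_eqF // ler_pdivlMr // => /(_ isT); left; nra.
  + by rewrite hj mulr0; lra.
- apply: (@supp_proper _ _ i) => [j pj||].
  + rewrite !mxE pj; have [] := hp j; rewrite pj ltxx => hp1 hp2.
    have -> : h j 0 = 0 by have [/hp2|/hp1|] := ltgtP (h j 0) 0.
    by rewrite mulr0 subr0.
  + by rewrite -tE mulf_neq0 // gt_eqF.
  + by rewrite !mxE tE subrr.
Qed.

(* Splitting p into at most #|supp p| conformal circuits, one of them captures
   the average decrease of u. *)
Lemma conformal_decrease A u p : A *m p = 0 -> dot u p < 0 ->
  exists h, [/\ elementary A h, conformal h p & n%:R * dot u h <= dot u p].
Proof.
move=> Ap up; suff [h [hE hp uh]] : exists h,
    [/\ elementary A h, conformal h p & #|supp p|%:R * dot u h <= dot u p].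
  exists h; split => //; apply: (le_trans _ uh).
  have k0 : (0 : R) <= #|supp p|%:R by [].
  have kn : (#|supp p|%:R : R) <= n%:R by rewrite ler_nat -[leqRHS]card_ord
    max_card.
  have [uh0|uh0] := lerP (dot u h) 0; first by rewrite ler_wnM2r.
  by move: up; rewrite ltNge (le_trans _ uh) // mulr_ge0 // ltW.
move: {2}#|supp p|.+1 (ltnSn #|supp p|) => k.
elim: k p Ap up => // k IH p Ap up pk.
have p0 : p != 0 by apply: contraTneq up => ->; rewrite dot0 ltxx.
have [h [hE hp /proper_card hs]] := conformal_elementary Ap p0.
(* If [h] falls short of the average decrease, then [p - h] has smaller support and at least the
   same average decrease, so the induction hypothesis applies to it. *)
have [uh|uh] := lerP (#|supp p|%:R * dot u h) (dot u p); first by exists h.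
have Ah : A *m h = 0 by case: hE.
have s1 : (#|supp (p - h)|%:R + 1 : R) <= #|supp p|%:R.
  by rewrite natr1 ler_nat.
have s0 : (0 : R) <= #|supp (p - h)|%:R by [].
move: s1 s0 uh; set s' := #|supp (p - h)|%:R; set s := #|supp p|%:R => s1 s0 uh.
have uB := dotB u p h.
have uph : dot u (p - h) < 0 by rewrite uB; nra.
have [||h' [h'E h'p uh']] := IH (p - h) _ uph;
  first by rewrite mulmxBr Ap Ah subr0.
  exact: leq_trans hs pk.
exists h'; split => //.
  apply: conformal_trans h'p _ => i; rewrite !mxE.
  by have [] := hp i; lra.
move: uh'; rewrite uB -/s' => uh'.
have s'0 : 0 < s' by rewrite lt_def s0 andbT; apply: contraTneq uh' => ->; nra.
have s0' : 0 < s by lra.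
rewrite -/s -(ler_pM2l s'0).
have : s * (s' * dot u h') <= s * (dot u p - dot u h) by rewrite ler_pM2l.
by nra.
Qed.

Lemma max_step_ratio A b x h alpha k : polyhedron A b x -> A *m h = 0 ->
    (forall i, h i 0 < 0 -> alpha <= x i 0 / - h i 0) ->
    h k 0 < 0 -> alpha = x k 0 / - h k 0 ->
  max_step A b x h alpha.
Proof.
move=> [Ax x0] Ah amin hk aE.
have hkN : 0 < - h k 0 by rewrite oppr_gt0.
have a0 : 0 <= alpha by rewrite aE divr_ge0 // ltW.
split=> [|beta [_ xb0]].
  split=> [|i]; first by rewrite mulmxDr -scalemxAr Ah scaler0 addr0.
  rewrite !mxE; have [hi|hi] := ltP (h i 0) 0.
    by have := amin i hi; rewrite ler_pdivlMr ?oppr_gt0 //; lra.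
  by rewrite addr_ge0 // mulr_ge0.
by have := xb0 k; rewrite !mxE aE ler_pdivlMr //; lra.
Qed.

(** The blocking coordinate [k] is exposed because the walk arguments depend on which coordinate
    reaches 0. *)
Lemma max_step_exists A b x h j : polyhedron A b x -> A *m h = 0 -> h j 0 < 0 ->
  exists alpha k, [/\ max_step A b x h alpha, 0 <= alpha, h k 0 < 0 &
    x k 0 + alpha * h k 0 = 0].
Proof.
move=> Px Ah hj.
have [k hk amin] := @arg_minP _ _ _ j (fun i => h i 0 < 0)
  (fun i => x i 0 / - h i 0) hj.
exists (x k 0 / - h k 0), k; split => //.
- exact: max_step_ratio amin hk _.
- by rewrite divr_ge0 ?oppr_ge0 ?(ltW hk) //; case: Px.
- by field; rewrite lt_eqF.
Qed.

Lemma polyhedron_ker A b x y : polyhedron A b x -> polyhedron A b y ->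
  A *m (y - x) = 0.
Proof. by move=> [Ax _] [Ay _]; rewrite mulmxBr Ax Ay subrr. Qed.

End Circuits.

(** * Steps that shrink the large coordinates or send one of them to zero *)

Section Walks.
Context {R : realType} {m n : nat}.
Implicit Types (A : 'M[R]_(m, n)) (b : 'cV[R]_m) (c u x y p h : 'cV[R]_n).
Implicit Type S : {set 'I_n}.

Lemma dot_indicator S x :
  dot (\col_i (i \in S)%:R) x = \sum_(i in S) x i 0.
Proof.
rewrite /dot [RHS]big_mkcond; apply: eq_bigr => i _.
by rewrite mxE; case: ifP => _; rewrite ?mul1r ?mul0r.
Qed.

(** The circuit is chosen in [y - x] for the objective that sums the coordinates in [S]. As
    [x > 2 y] there, moving to [y] would at least halve this sum, so one circuit removes at least a
    fraction [1 / (2 n)] of it. A conformal circuit never increases coordinate [i] by more than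
    [y i 0] per unit of step. *)
Lemma greedy_step A b x y S : polyhedron A b x -> polyhedron A b y ->
    S != finset.set0 -> (forall i, i \in S -> 2 * y i 0 < x i 0) ->
  exists h alpha, [/\ elementary A h, max_step A b x h alpha,
    2 * n%:R * (\sum_(i in S) (x + alpha *: h) i 0) <=
      (2 * n%:R - 1) * \sum_(i in S) x i 0,
    forall i, i \in S -> (x + alpha *: h) i 0 <= x i 0 &
    forall i, (x + alpha *: h) i 0 <= x i 0 + 2 * n%:R * y i 0].
Proof.
move=> Px Py /set0Pn[i0 i0S] Sx.
have [[_ x0] [_ y0]] := (Px, Py).
have N0 : (0 : R) < n%:R by rewrite ltr0n; case: (n) i0 {i0S} => [[]|].
pose u : 'cV[R]_n := \col_i (i \in S)%:R.
have X0 : 0 < \sum_(i in S) x i 0.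
  rewrite (bigD1 i0) //= ltr_wpDr ?sumr_ge0 // (le_lt_trans _ (Sx i0 i0S)) //.
  by rewrite mulr_ge0.
have uX z : dot u z = \sum_(i in S) z i 0 by rewrite dot_indicator.
have uYX : 2 * dot u y <= dot u x.
  by rewrite !uX mulr_sumr; apply: ler_sum => i /Sx /ltW.
rewrite -uX in X0.
have ud : dot u (y - x) = dot u y - dot u x by rewrite dotB.
have [|h [hE hp]] := @conformal_decrease _ _ _ A u (y - x) (polyhedron_ker Px
  Py).
  by rewrite ud; lra.
have Ah : A *m h = 0 by case: hE.
rewrite ud => uh.
have [j jS hj] : exists2 j, j \in S & h j 0 < 0.
  apply/exists2P; apply: contrapT => /forallNP hS.
  suff : 0 <= dot u h by nra.
  by rewrite uX sumr_ge0 // => i iS; rewrite leNgt; apply/negP => hi;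
    case: (hS i).
have [alpha [k [ha a0 hk xk]]] := max_step_exists Px Ah hj.
have [[_ xa0] amax] := ha.
(* By conformality [x + h] lies coordinatewise between [x] and [y], so a unit step is feasible. *)
have a1 : 1 <= alpha.
  apply: amax; split=> [|i]; first by rewrite scale1r mulmxDr Ah addr0;
    case: Px.
  by rewrite scale1r mxE; have := hp i; rewrite !mxE; have := x0 i;
    have := y0 i; lra.
have ua : dot u (x + alpha *: h) = dot u x + alpha * dot u h by rewrite dotD
  dotZ.
have ua0 : 0 <= dot u (x + alpha *: h) by rewrite uX sumr_ge0.
have uh2 : 2 * n%:R * dot u h <= - dot u x by lra.
(* A longer step would make the nonnegative sum over [S] negative. *)
have a2 : alpha <= 2 * n%:R by rewrite ua in ua0; nra.
exists h, alpha; split => //.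
- by rewrite -!uX ua; nra.
- move=> i iS; rewrite !mxE; have := hp i; rewrite !mxE.
  by have := Sx i iS; have := y0 i; nra.
- move=> i; rewrite !mxE; have := hp i; rewrite !mxE.
  by have := x0 i; have := y0 i; nra.
Qed.

(* The coordinates in S shrank by a factor 12 n K ^ 2 between x0 and x, so a
   tiny multiple theta of y - x0 already sends some coordinate of S from its
   current value to 0.  Adding 2 K theta (y - x) makes the direction increase
   the coordinates outside of S that are small compared to y, and the maximal
   step is too short to kill any of the large ones. *)
Lemma killing_step A b x0 x y S K : polyhedron A b x0 -> polyhedron A b x ->
    polyhedron A b y -> 1 <= K ->
    (forall i, i \in S -> 2 * y i 0 < x0 i 0 /\ 2 * y i 0 < x i 0) ->
    (forall i, i \notin S -> x0 i 0 <= K * y i 0 /\ x i 0 <= K * y i 0) ->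
    12 * n%:R * K ^+ 2 * (\sum_(i in S) x i 0) < \sum_(i in S) x0 i 0 ->
  exists h alpha, [/\ elementary A h, max_step A b x h alpha,
    exists2 i, i \in S & (x + alpha *: h) i 0 = 0,
    forall i, i \in S -> (x + alpha *: h) i 0 <= x i 0 &
    forall i, i \notin S -> (x + alpha *: h) i 0 <= x i 0 + y i 0].
Proof.
move=> Px0 Px Py K1 inS outS small.
have [[_ x00] [[_ x0'] [_ y0]]] := (Px0, (Px, Py)).
have [j jS xj] : exists2 j, j \in S & 12 * n%:R * K ^+ 2 * x j 0 < x0 j 0.
  apply/exists2P; apply: contrapT => /forallNP hS.
  move: small; rewrite ltNge => /negP; apply;
    rewrite mulr_sumr ler_sum // => i iS.
  by rewrite leNgt; apply/negP => hi; case: (hS i).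
have N1 : (1 : R) <= n%:R by rewrite ler1n; case: (n) j {jS xj} => [[]|].
have [i iS tmin] := @arg_minP _ _ _ j (fun i => i \in S)
  (fun i => x i 0 / (x0 i 0 - y i 0)) jS.
set t := x i 0 / (x0 i 0 - y i 0) in tmin *.
have [x0i xi] := inS i iS.
have yi := y0 i.
have xy0 : 0 < x0 i 0 - y i 0 by lra.
have tE : t * (x0 i 0 - y i 0) = x i 0 by rewrite /t; field; rewrite gt_eqF.
have t0 : 0 < t by rewrite divr_gt0 //; lra.
(* Coordinate [j] shrank by the factor [12 n K ^ 2], and [x0 j 0 - y j 0] exceeds half of [x0 j 0];
   this loses a factor 2. *)
have tK : 6 * n%:R * K ^+ 2 * t < 1.
  have [x0j xj'] := inS j jS; have yj := y0 j.
  have xyj : 0 < x0 j 0 - y j 0 by lra.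
  have := tmin j jS; rewrite ler_pdivlMr // => tj.
  have e : 0 <= 6 * n%:R * K ^+ 2 by rewrite !mulr_ge0 ?exprn_ge0 //; lra.
  by rewrite -(ltr_pM2r xyj); have := ler_wpM2l e tj; lra.
pose N : R := n%:R; rewrite -/N in tK xj N1.
have tK3 : 3 * N * (K ^+ 2 * t) < 2^-1 by lra.
have KK : K <= K ^+ 2 by rewrite expr2; nra.
have tK1 : K * t <= K ^+ 2 * t by rewrite ler_pM2r.
have tKN : t <= K * t by nra.
pose p := t *: (y - x0) + (2 * (K * t)) *: (y - x).
have pE k : p k 0 = t * (y k 0 - x0 k 0) + 2 * (K * t) * (y k 0 - x k 0).
  by rewrite !mxE.
have Ap : A *m p = 0.
  by rewrite mulmxDr -!scalemxAr (polyhedron_ker Px0 Py) (polyhedron_ker Px Py)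
    !scaler0 addr0.
(* The first summand of [p] alone contributes exactly [- x i 0], and the second is not positive on
   [S]. A best circuit for coordinate [i] thus removes at least [x i 0 / n] per unit, which gives
   [alpha <= n]. *)
have pi : p i 0 <= - x i 0 by rewrite pE; nra.
pose u : 'cV[R]_n := \col_k (k \in [set i]%SET)%:R.
have uE z : dot u z = z i 0 by rewrite dot_indicator big_set1.
have [|h [hE hp]] := @conformal_decrease _ _ _ A u p Ap; first by rewrite uE;
  lra.
rewrite !uE -/N => hi.
have Ah : A *m h = 0 by case: hE.
have hi0 : h i 0 < 0 by nra.
have [alpha [k [ha a0 hk xk]]] := max_step_exists Px Ah hi0.
have [[_ xa0] _] := ha.
have aN : alpha <= N by have := xa0 i; rewrite !mxE; nra.
clear small xj tmin tE tK xy0 Ap uE hi Ah hi0 pi x0i xi yi xa0.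
have aP z w : 0 <= z -> w <= z -> alpha * w <= N * z by nra.
clear aN N1 KK.
exists h, alpha; split => //.
- exists k; last by rewrite !mxE.
  (* Suppose the blocking [k] is outside [S]. Since [p] decreases it, [x k 0] is at least
     [y k 0 / 2]; but the total decrease is at most [3 n K ^ 2 t y k 0], which is less than
     [y k 0 / 2]. *)
  apply: contraTT isT => /outS[x0k xk'].
  have pk : p k 0 <= h k 0 by have := hp k; lra.
  have yk := y0 k.
  have ptk : t * x0 k 0 <= K * t * y k 0 by nra.
  have ptk' : (K * t) * x k 0 <= K ^+ 2 * t * y k 0.
    by rewrite expr2; have := ler_wpM2l (ltW (lt_le_trans t0 tKN)) xk'; lra.
  have pk' : p k 0 < 0 by lra.
  rewrite pE in pk pk'.
  have yk0 : 0 < y k 0.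
    rewrite lt_def yk andbT; apply/eqP => y0k; rewrite y0k !mulr0 in x0k xk'.
    by move: pk'; have := x00 k; have := x0' k; nra.
  have xky : y k 0 / 2 <= x k 0.
    rewrite leNgt; apply/negP => xky.
    have : 0 <= (K * t) * (y k 0 / 2 - x k 0) by rewrite mulr_ge0 //; lra.
    by nra.
  have ty0 : 0 <= K * t * y k 0 by rewrite mulr_ge0 //; lra.
  have ty1 : K * t * y k 0 <= K ^+ 2 * t * y k 0 by rewrite ler_pM2r.
  have ty2 : 0 <= t * y k 0 by rewrite mulr_ge0 // ltW.
  have := aP (3 * (K ^+ 2 * t * y k 0)) (- h k 0).
  have : (3 * N * (K ^+ 2 * t)) * y k 0 < 2^-1 * y k 0 by rewrite ltr_pM2r.
  by lra.
- move=> l lS; rewrite !mxE; have := hp l; rewrite pE.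
  have [x0l xl] := inS l lS; have yl := y0 l.
  have : t * (y l 0 - x0 l 0) <= 0 by nra.
  have : K * t * (y l 0 - x l 0) <= 0 by nra.
  by nra.
- move=> l lS; rewrite !mxE; have := hp l; rewrite pE.
  have [x0l xl] := outS l lS; have yl := y0 l.
  have e1 : t * (y l 0 - x0 l 0) <= K ^+ 2 * t * y l 0.
    have : 0 <= t * x0 l 0 by rewrite mulr_ge0 // ltW.
    have : t * y l 0 <= K ^+ 2 * t * y l 0 by rewrite ler_wpM2r //; lra.
    by lra.
  have e2 : K * t * (y l 0 - x l 0) <= K ^+ 2 * t * y l 0.
    have : 0 <= K * t * x l 0 by rewrite mulr_ge0 //; lra.
    have : K * t * y l 0 <= K ^+ 2 * t * y l 0 by rewrite ler_wpM2r.
    by lra.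
  have := aP (3 * (K ^+ 2 * t * y l 0)) (h l 0).
  have : (3 * N * (K ^+ 2 * t)) * y l 0 <= 2^-1 * y l 0 by rewrite ler_wpM2r //
    ltW.
  have : 0 <= K ^+ 2 * t * y l 0 by rewrite mulr_ge0 //; lra.
  by lra.
Qed.

End Walks.

(** * A short circuit walk to an optimal point *)

Lemma bernoulli_nat a k : (a ^ k.+1 + k.+1 * a ^ k <= a.+1 ^ k.+1)%N.
Proof.
elim: k => [|k IH]; first by rewrite !expn1 expn0 muln1 addn1.
rewrite [leqRHS]expnS; apply: leq_trans (leq_mul (leqnn _) IH).
by rewrite (expnS a k.+1) (expnS a k); lia.
Qed.

(** By Bernoulli, [2 n] greedy steps at least halve the sum, so [40 n ^ 2] of them gain a factor
    [2 ^ (20 n)], which beats the polynomial factor required by the killing step. The squared term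
    is the largest value that [K] takes over [n] phases. *)
Lemma phase_length n : (2 <= n)%N ->
  (12 * n * (2 + 2 * n * (n * (40 * n ^ 2).+1)) ^ 2 * (2 * n).-1 ^ (40 * n ^ 2)
    <
     (2 * n) ^ (40 * n ^ 2))%N.
Proof.
move=> n2; set T := (40 * n ^ 2)%N.
have halve : (2 * (2 * n).-1 ^ (2 * n) <= (2 * n) ^ (2 * n))%N.
  have e : (2 * n).-1.+1 = (2 * n)%N by lia.
  rewrite -{3 4}e; apply: leq_trans (bernoulli_nat _ _);
    rewrite -{2}e mul2n -addnn leq_add2l.
  by rewrite expnS leq_mul2r leqnSn orbT.
have halveT : (2 ^ (20 * n) * (2 * n).-1 ^ T <= (2 * n) ^ T)%N.
  have -> : T = (2 * n * (20 * n))%N by rewrite /T; lia.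
  by rewrite !(expnM _ (2 * n)) -expnMn leq_exp2r // muln_gt0; lia.
apply: leq_trans halveT.
rewrite ltn_pmul2r ?expn_gt0; last by apply/orP; left; lia.
(* The exponents add up to [2 n + n + 2 (4 n + 4 n) = 19 n], below [20 n]. *)
have c1 : (12 <= 2 ^ (2 * n))%N.
  by apply: (@leq_trans (2 ^ 4)) => //; rewrite leq_exp2l //; lia.
have c2 : (81 <= 2 ^ (4 * n))%N.
  by apply: (@leq_trans (2 ^ 7)) => //; rewrite leq_exp2l //; lia.
have c3 : (2 + 2 * n * (n * T.+1) <= 81 * n ^ 4)%N.
  rewrite /T; have : (4 <= n ^ 2)%N by rewrite (@leq_exp2r 2 n 2).
  by rewrite (expnM n 2 2) -[(n ^ 2)%N]/(n * n)%N expnS expn1; nia.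
have c4 := ltn_expl n (ltnSn 1).
apply: (@leq_ltn_trans (12 * n * (81 * n ^ 4) ^ 2)).
  by rewrite leq_mul // leq_exp2r.
apply: (@leq_ltn_trans (2 ^ (2 * n) * 2 ^ n * (2 ^ (4 * n) * 2 ^ (4 * n)) ^ 2)).
  apply: leq_mul; first by rewrite leq_mul // ltnW.
  rewrite leq_exp2r // leq_mul // (mulnC 4) expnM leq_exp2r //.
  exact: ltnW.
by rewrite -!expnD -expnM -expnD ltn_exp2l //; lia.
Qed.

Section CircuitDiameter.
Context {R : realType} {m n : nat}.
Implicit Types (A : 'M[R]_(m, n)) (b : 'cV[R]_m) (c u x y p h : 'cV[R]_n).
Implicit Types (S : {set 'I_n}) (K : R).

Fixpoint walk A b (k : nat) x x' : Prop :=
  if k is k'.+1 then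
    exists h alpha, [/\ elementary A h, max_step A b x h alpha &
      walk A b k' (x + alpha *: h) x']
  else x' = x.

Lemma walk_cat A b j k x y z : walk A b j x y -> walk A b k y z ->
  walk A b (j + k) x z.
Proof.
elim: j x => [|j IH] x /=; first by move=> ->.
by move=> [h [a [hE ha w1 w2]]]; exists h, a; split => //; exact: IH.
Qed.

Lemma walk_polyhedron A b k x x' : polyhedron A b x -> walk A b k x x' ->
  polyhedron A b x'.
Proof.
elim: k x => [|k IH] x Px /=; first by move=> ->.
by move=> [h [a [_ [Pxa _] w]]]; exact: IH w.
Qed.

(** The invariant of the walk: [S] loses an element in each phase, while [K] grows only
    additively. *)
Definition separated S (K : R) y x :=
  (forall i, i \in S -> 2 * y i 0 < x i 0) /\
  (forall i, i \notin S -> x i 0 <= K * y i 0).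

(** A coordinate that has dropped to at most [2 y] meets the bound imposed outside the set, as
    [K >= 2], so all such coordinates can be discarded. *)
Lemma separated_shrink S K y x i : 2 <= K -> (forall i, 0 <= y i 0) ->
    (forall i, i \notin S -> x i 0 <= K * y i 0) ->
    i \in S -> x i 0 <= 2 * y i 0 ->
  exists2 S' : {set 'I_n}, S' \proper S & separated S' K y x.
Proof.
move=> K2 y0 outS iS xi; exists [set j in S | 2 * y j 0 < x j 0]%SET.
  apply/properP; split; first by apply/fintype.subsetP => j;
    rewrite !inE => /andP[].
  by exists i; rewrite // !inE iS ltNge xi.
split=> j; first by rewrite !inE => /andP[].
rewrite !inE negb_and => /orP[/outS //|]; rewrite -leNgt => xj.
by apply: le_trans xj _; rewrite ler_wpM2r.
Qed.

(** Greedy steps are made until an element leaves [S], or [t] times; each one adds at most [2 n] to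
    [K] and multiplies the sum over [S] by at most [1 - 1 / (2 n)]. *)
Lemma greedy_phase A b x0 y S K t : polyhedron A b x0 -> polyhedron A b y ->
    S != finset.set0 -> 2 <= K -> separated S K y x0 ->
  exists k x, [/\ (k <= t)%N, walk A b k x0 x &
    (exists2 S' : {set 'I_n}, S' \proper S & separated S' (K + 2 * n%:R * t%:R)
      y x) \/
    (separated S (K + 2 * n%:R * t%:R) y x /\
     (2 * n%:R) ^+ t * (\sum_(i in S) x i 0) <=
       (2 * n%:R - 1) ^+ t * \sum_(i in S) x0 i 0)].
Proof.
move=> Px0 Py S0 K2 sx0.
have y0 : forall i, 0 <= y i 0 by case: Py.
have weaken j (z : 'cV[R]_n) S' : separated S' (K + 2 * n%:R * j%:R) y z ->
    separated S' (K + 2 * n%:R * j.+1%:R) y z.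
  move=> [inS outS]; split=> // i /outS /le_trans; apply.
  rewrite ler_wpM2r // lerD2l ler_wpM2l ?ler_nat //.
elim: t => [|t [k [x [kt wx [[S' S'S sx]|[sx dec]]]]]].
- exists 0%N, x0; split => //; right; rewrite !expr0 !mul1r mulr0 addr0.
  by split.
- exists k, x; split; [exact: leqW|by []|left; exists S' => //].
  exact: weaken.
have Px := walk_polyhedron Px0 wx.
have [h [alpha [hE ha dech inh outh]]] := greedy_step Px Py S0 sx.1.
set x' := x + alpha *: h in dech inh outh.
have wx' : walk A b k.+1 x0 x'.
  by rewrite -addn1; apply: walk_cat wx _; exists h, alpha.
have out' i : i \notin S -> x' i 0 <= (K + 2 * n%:R * t.+1%:R) * y i 0.
  move=> iS; have := sx.2 i iS; have := outh i.
  by rewrite -(natr1 t); lra.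
have K2' : 2 <= K + 2 * n%:R * t.+1%:R.
  by rewrite (le_trans K2) // lerDl !mulr_ge0.
exists k.+1, x'; split => //.
have [[i iS xi]|ngt] := pselect (exists2 i, i \in S & x' i 0 <= 2 * y i 0).
  by left; apply: separated_shrink xi.
right; split.
  split=> // i iS; rewrite ltNge; apply/negP => xi; apply: ngt.
  by exists i.
have n1 : (0 : R) <= 2 * n%:R - 1.
  move/set0Pn: S0 => [i _]; have : (1 : R) <= n%:R by rewrite ler1n;
    case: (n) i => [[]|].
  by lra.
move: n1 dech dec; move: (2 * n%:R) => a a1 dech dec.
have a0 : 0 <= a by lra.
apply: (@le_trans _ _ (a ^+ t * ((a - 1) * \sum_(i in S) x i 0))).
  by rewrite exprSr -mulrA; apply: ler_wpM2l dech; rewrite exprn_ge0.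
rewrite mulrCA exprS -mulrA; exact: ler_wpM2l.
Qed.

(** Either an element of [S] is lost during [T] greedy steps, or the sum over [S] has become small
    enough for one killing step, which accounts for the bound [T.+1]. *)
Lemma phase A b x0 y S K Kmax T : polyhedron A b x0 -> polyhedron A b y ->
    S != finset.set0 -> 2 <= K -> separated S K y x0 ->
    K + 2 * n%:R * T%:R <= Kmax ->
    12 * n%:R * Kmax ^+ 2 * (2 * n%:R - 1) ^+ T < (2 * n%:R) ^+ T ->
  exists k x (S' : {set 'I_n}), [/\ (k <= T.+1)%N, walk A b k x0 x, S' \proper
    S &
    separated S' (K + 2 * n%:R * T.+1%:R) y x].
Proof.
move=> Px0 Py S0 K2 sx0 KT long.
have y0 : forall i, 0 <= y i 0 by case: Py.
have n1 : (1 : R) <= n%:R.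
  by move/set0Pn: S0 => [i _]; rewrite ler1n; case: (n) i => [[]|].
have KK' : K + 2 * n%:R * T.+1%:R = K + 2 * n%:R * T%:R + 2 * n%:R.
  by rewrite -(natr1 T); ring.
have [k [x [kT wx [[S' S'S sx]|[sx dec]]]]] := greedy_phase T Px0 Py S0 K2 sx0.
  exists k, x, S'; split => //; first exact: leqW.
  split; first exact: sx.1.
  move=> i /(sx.2) /le_trans; apply; rewrite ler_wpM2r // KK'; lra.
have Px := walk_polyhedron Px0 wx.
have nT0 : (0 : R) <= 2 * n%:R * T%:R by rewrite !mulr_ge0.
have Kmax1 : 1 <= Kmax by lra.
have X0 : 0 < \sum_(i in S) x0 i 0.
  move/set0Pn: S0 => [i iS]; have [_ x00] := Px0.
  rewrite (bigD1 i) //= ltr_wpDr ?sumr_ge0 // (le_lt_trans _ (sx0.1 i iS)) //.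
  by rewrite mulr_ge0.
have := @killing_step _ _ _ A b x0 x y S Kmax Px0 Px Py Kmax1.
case.
- by move=> i iS; split; [exact: sx0.1|exact: sx.1].
- move=> i iS; split.
    by apply: le_trans (sx0.2 i iS) _; rewrite ler_wpM2r //; lra.
  by apply: le_trans (sx.2 i iS) _; rewrite ler_wpM2r.
- have q0 : (0 : R) < (2 * n%:R) ^+ T by rewrite exprn_gt0 //; lra.
  rewrite -(ltr_pM2l q0); apply: le_lt_trans (_ : _ <= 12 * n%:R * Kmax ^+ 2 *
     ((2 * n%:R - 1) ^+ T * \sum_(i in S) x0 i 0)) _.
    rewrite mulrCA ler_wpM2l // !mulr_ge0 ?exprn_ge0 //; lra.
  by rewrite mulrA ltr_pM2r.
move=> h [alpha [hE ha [i iS xi] inh outh]].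
have [|||||S' S'S sx'] := @separated_shrink S (K + 2 * n%:R * T.+1%:R) y
  (x + alpha *: h) i.
- by rewrite KK'; lra.
- by [].
- move=> j jS; apply: le_trans (outh j jS) _; have := sx.2 j jS.
  by rewrite KK'; have := y0 j; nra.
- by [].
- by rewrite xi mulr_ge0.
exists k.+1, (x + alpha *: h), S'; split => //.
by rewrite -addn1; apply: walk_cat wx _; exists h, alpha.
Qed.

(** At most [n] phases empty [S]. Then every coordinate is at most [Kmax] times that of [y], hence
    vanishes wherever [y] does. The count is [n (40 n ^ 2 + 1) <= 41 n ^ 3]. *)
Lemma walk_to_support A b x y : (2 <= n)%N -> polyhedron A b x -> polyhedron A
  b y ->
  exists k x', [/\ (k <= 41 * n ^ 3)%N, walk A b k x x' &
    forall i, y i 0 = 0 -> x' i 0 = 0].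
Proof.
move=> n2 Px Py; pose T := (40 * n ^ 2)%N.
pose Kmax : R := 2 + 2 * n%:R * (n * T.+1)%:R.
have long : 12 * n%:R * Kmax ^+ 2 * (2 * n%:R - 1) ^+ T < (2 * n%:R) ^+ T.
  have := phase_length n2; rewrite -(ltr_nat R) -/T !(natrM, natrX, natrD).
  suff -> : (2 * n).-1%:R = 2 * n%:R - 1 :> R by rewrite /Kmax natrM.
  by rewrite -subn1 natrB ?natrM // muln_gt0; lia.
(* Here [s] is the number of phases still available; the last hypothesis reserves the growth of [K]
   that they may cause. *)
suff gen s S K z : (#|S| <= s)%N -> 2 <= K -> separated S K y z ->
    polyhedron A b z -> K + 2 * n%:R * (s * T.+1)%:R <= Kmax ->
    exists k x', [/\ (k <= s * T.+1)%N, walk A b k z x' &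
      separated finset.set0 Kmax y x'].
  have [|||||k [x' [kT wx' [_ sx']]]] := gen n [set i | 2 * y i 0 < x i 0]%SET
    2 x.
  - by rewrite -[leqRHS]card_ord max_card.
  - by [].
  - by split=> i; rewrite inE // -leNgt.
  - by [].
  - by [].
  exists k, x'; split=> // [|i yi].
    apply: leq_trans kT _; rewrite mulnS /T mulnCA -expnS (mulnDl 1 40) mul1n.
    by rewrite leq_add2r -{1}(expn1 n) leq_pexp2l //; lia.
  apply/eqP; rewrite eq_le; have [_ x'0] := walk_polyhedron Px wx'.
  by have := sx' i; rewrite inE yi mulr0 => /(_ isT) ->; rewrite x'0.
elim: s S K z => [|s IH] S K z.
  rewrite leqn0 cards_eq0 => /eqP -> K2 [_ outS] Pz KK.
  exists 0%N, z; split => //; split=> i; rewrite inE // => _.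
  apply: le_trans (outS i _) _; first by rewrite inE.
  rewrite mulr0 addr0 in KK.
  by rewrite ler_wpM2r //; case: Py.
move=> Ss K2 sz Pz KK.
have KT : K + 2 * n%:R * T.+1%:R + 2 * n%:R * (s * T.+1)%:R <= Kmax.
  by move: KK; rewrite mulSn natrD; lra.
have [S0|S0] := eqVneq S finset.set0.
  have [||k [x' [ks wx' sx']]] := IH S K z _ K2 sz Pz;
    first by rewrite S0 cards0.
    apply: le_trans KT; rewrite lerD2r lerDl !mulr_ge0 //.
  by exists k, x'; split => //; apply: leq_trans ks _;
    rewrite leq_mul2r leqnSn orbT.
have [|//|k [z' [S' [kT wz' S'S sz']]]] := @phase A b z y S K Kmax T Pz Py S0
  K2 sz.
  apply: le_trans KT; rewrite -addrA lerD2l -mulrDr ler_wpM2l ?mulr_ge0 //.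
  by rewrite -natrD ler_nat; lia.
have [|||k' [x' [ks wx' sx']]] := IH S' _ z' _ _ sz' _ KT.
- by have := proper_card S'S; lia.
- by rewrite (le_trans K2) // lerDl !mulr_ge0.
- exact: walk_polyhedron wz'.
exists (k + k')%N, x'; split => //; first by rewrite mulSn leq_add.
exact: walk_cat wx'.
Qed.

(** The segment from [x] to [y] can be prolonged beyond [y], because a coordinate that blocks at [y]
    is 0 in [x] too. Optimality of [y] then shows that the objective cannot decrease from [x] to
    [y]. *)
Lemma supp_optimal A b c x y : lp_optimal A b c y -> polyhedron A b x ->
  (forall i, y i 0 = 0 -> x i 0 = 0) -> lp_optimal A b c x.
Proof.
move=> [Py ymin] Px yx; split=> // z Pz; apply: le_trans (ymin z Pz).
have [_ y0] := Py; have Ayx : A *m (y - x) = 0 := polyhedron_ker Px Py.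
have [ge0|[j hj]] : (forall i, 0 <= (y - x) i 0) \/ exists j, (y - x) j 0 < 0.
  have [ex|nex] := pselect (exists j, (y - x) j 0 < 0); [by right|left=> i].
  by rewrite leNgt; apply/negP => hi; apply: nex; exists i.
  have := ymin (y + (y - x)); rewrite !dotD dotN => le.
  suff : polyhedron A b (y + (y - x)) by move/le; lra.
  split=> [|i]; first by rewrite mulmxDr Ayx addr0; case: Py.
  by rewrite mxE addr_ge0.
have [alpha [k [[Pa _] a0 hk yk]]] := max_step_exists Py Ayx hj.
have a1 : 0 < alpha.
  rewrite lt_def a0 andbT; apply: contraTneq hk => a00.
  by move: yk; rewrite a00 mul0r addr0 -leNgt => yk;
    rewrite !mxE yk yx // subr0.
have := ymin _ Pa; rewrite dotD dotZ dotB; nra.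
Qed.

(** As long as the columns in the support are dependent, a kernel direction that does not increase
    the objective is followed until a coordinate of the support vanishes. *)
Lemma basic_improvement A b c x L : (forall z, polyhedron A b z -> L <= dot c
  z) ->
    polyhedron A b x ->
  exists x', [/\ polyhedron A b x', dot c x' <= dot c x & basic A x'].
Proof.
move=> bnd; move: {2}#|supp x|.+1 (ltnSn #|supp x|) => k.
elim: k x => // k IH x xk Px.
have [bx|nbx] := pselect (basic A x); first by exists x.
have [d [Ad ds d0]] : exists d, [/\ A *m d = 0, supp d \subset supp x & d != 0].
  apply: contrapT => nd; apply: nbx => d Ad ds; apply/eqP/negPn/negP => d0.
  by apply: nd; exists d.
have [d' [Ad' d's [j d'j] cd']] : exists d', [/\ A *m d' = 0, supp d' \subset
  supp x,
    exists j, d' j 0 < 0 & dot c d' <= 0].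
  have Nd : supp (- d) \subset supp x by rewrite -scaleN1r suppZ // oppr_eq0
    oner_eq0.
  have ANd : A *m (- d) = 0 by rewrite mulmxN Ad oppr0.
  have [j dj] := neq0_coord d0.
  have descent e : A *m e = 0 -> dot c e < 0 -> exists j, e j 0 < 0.
    move=> Ae ce; apply: contrapT => ne.
    have e0 i : 0 <= e i 0 by rewrite leNgt; apply/negP => ei; apply: ne;
      exists i.
    (* A nonnegative descent direction could be followed this far, which would push the objective
       below [L]. *)
    pose t := (`|dot c x - L| + 1) / - dot c e.
    have t0 : 0 <= t by rewrite divr_ge0 ?addr_ge0 //; lra.
    have te : t * dot c e = - (`|dot c x - L| + 1) by rewrite /t; field;
      rewrite lt_eqF.
    have := bnd (x + t *: e); rewrite dotD dotZ te => h.
    have := ler_norm (dot c x - L);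
      suff : polyhedron A b (x + t *: e) by move/h; lra.
    have [Ax x0] := Px; split=> [|i];
      first by rewrite mulmxDr -scalemxAr Ae scaler0 addr0.
    by rewrite !mxE addr_ge0 // mulr_ge0.
  have [cd|cd|cd] := ltgtP (dot c d) 0.
  - by exists d; split; rewrite ?ltW //; exact: descent.
  - by exists (- d); split; rewrite ?dotN ?oppr_le0 ?ltW //; apply: descent;
    rewrite // dotN oppr_lt0.
  - move: dj; rewrite neq_lt => /orP[] dj; first by exists d; split;
    rewrite ?cd //; exists j.
    by exists (- d); split; rewrite ?dotN ?cd ?oppr0 //; exists j;
      rewrite mxE oppr_lt0.
have [alpha [l [[Pa _] a0 hl xl]]] := max_step_exists Px Ad' d'j.
have d'z i : x i 0 = 0 -> d' i 0 = 0.
  move/fintype.subsetP: d's => /(_ i); rewrite !in_supp => di xi.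
  by apply/eqP/negPn/negP => /di; rewrite xi eqxx.
have [|x' [Px' cx' bx']] := IH (x + alpha *: d') _ Pa.
  have /proper_card : supp (x + alpha *: d') \proper supp x.
    apply: (@supp_proper _ _ _ _ l) => [i xi||]; last by rewrite !mxE.
      by rewrite !mxE xi d'z // mulr0 addr0.
    by apply: contraTneq hl => /d'z ->; rewrite ltxx.
  by lia.
exists x'; split => //; apply: le_trans cx' _; rewrite dotD dotZ; nra.
Qed.

Lemma basic_unique A b x x' : polyhedron A b x -> polyhedron A b x' ->
  basic A x -> supp x' = supp x -> x' = x.
Proof.
move=> Px Px' bx xx'; apply/eqP; rewrite -subr_eq0; apply/eqP/bx.
  exact: polyhedron_ker Px Px'.
apply/fintype.subsetP => i; rewrite !in_supp; apply: contraNN => /eqP xi.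
have : i \notin supp x' by rewrite xx' in_supp xi eqxx.
by rewrite in_supp negbK !mxE xi subr0.
Qed.

(** A basic feasible point is determined by its support, so minimizing over the finitely many
    supports of such points suffices. *)
Lemma lp_optimal_exists A b c x : polyhedron A b x ->
  has_lbound (lp_values A b c) -> exists y, lp_optimal A b c y.
Proof.
move=> Px [L Lb].
have bnd z : polyhedron A b z -> L <= dot c z by move=> Pz; apply: Lb; exists z.
pose good S z := [/\ polyhedron A b z, basic A z & supp z = S].
pose pick S : 'cV[R]_n := xget 0 [set z | good S z].
pose ok S := `[< exists z, good S z >].
have okP S : ok S -> good S (pick S).
  by move=> /asboolP[z gz]; rewrite /pick; case: xgetP => [z' _ //|/(_ z)].
have impr z : polyhedron A b z -> exists2 S, ok S & dot c (pick S) <= dot c z.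
  move=> Pz; have [z' [Pz' cz' bz']] := basic_improvement bnd Pz.
  have okS : ok (supp z') by apply/asboolP; exists z'.
  exists (supp z') => //; have [Pp bp sp] := okP _ okS.
  by rewrite (basic_unique Pz' Pp bz' sp).
have [S0 okS0 _] := impr x Px.
have [S okS Smin] := @arg_minP _ _ _ S0 ok (fun S => dot c (pick S)) okS0.
exists (pick S); split=> [|z Pz]; first by have [] := okP S okS.
by have [S' /Smin le1 le2] := impr z Pz; exact: le_trans le1 le2.
Qed.

Lemma walk_to_optimal A b c x : (2 <= n)%N -> polyhedron A b x ->
    has_lbound (lp_values A b c) ->
  exists k x', [/\ (k <= 41 * n ^ 3)%N, walk A b k x x' & lp_optimal A b c x'].
Proof.
move=> n2 Px bnd; have [y yopt] := lp_optimal_exists Px bnd.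
have [k [x' [kn wx' yx']]] := walk_to_support n2 Px yopt.1.
exists k, x'; split => //; apply: supp_optimal yopt _ yx'.
exact: walk_polyhedron wx'.
Qed.

End CircuitDiameter.

(** * Sign patterns and the optimality test *)

Section Oracle.
Context {R : realType} {m n : nat}.
Implicit Types (A : 'M[R]_(m, n)) (b : 'cV[R]_m) (c u x y z p q h : 'cV[R]_n).
Implicit Types v w : 'I_n -> \bar R.

(** An infinite weight counts as 0 here, which is harmless when the corresponding entries vanish. *)
Definition rweight v w p q : R :=
  \sum_i fine (v i) * p i 0 + \sum_i fine (w i) * q i 0.

Lemma weightedE v w p q : (forall i, v i \isn't a fin_num -> p i 0 = 0) ->
  (forall i, w i \isn't a fin_num -> q i 0 = 0) ->
  weighted v w p q = (rweight v w p q)%:E.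
Proof.
move=> vp wq; rewrite /weighted /rweight EFinD -!sumEFin.
congr (_ + _)%E; apply: eq_bigr => i _.
  have [/fineK {1}<-|/vp ->] := boolP (v i \is a fin_num);
    first by rewrite EFinM.
  by rewrite mulr0 mule0.
have [/fineK {1}<-|/wq ->] := boolP (w i \is a fin_num); first by rewrite EFinM.
by rewrite mulr0 mule0.
Qed.

Lemma rweightZ v w a p q : rweight v w (a *: p) (a *: q) = a * rweight v w p q.
Proof.
rewrite /rweight mulrDr !mulr_sumr.
by congr (_ + _); apply: eq_bigr => i _; rewrite mxE mulrCA.
Qed.

Lemma rweight_ge0 v w p q : (forall i, 0 <= v i)%E -> (forall i, 0 <= w i)%E ->
  (forall i, 0 <= p i 0) -> (forall i, 0 <= q i 0) -> 0 <= rweight v w p q.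
Proof. by move=> *; rewrite addr_ge0 // sumr_ge0 // => i _;
  rewrite mulr_ge0 ?fine_ge0. Qed.

Section Terms.
Variables (v w : 'I_n -> \bar R) (p q : 'cV[R]_n).
Hypotheses (v0 : forall i, (0 <= v i)%E) (w0 : forall i, (0 <= w i)%E).
Hypotheses (p0 : forall i, 0 <= p i 0) (q0 : forall i, 0 <= q i 0).
Hypothesis pq1 : (weighted v w p q <= 1)%E.

Let vp0 i : (0 <= v i * (p i 0)%:E)%E. Proof. by rewrite mule_ge0 ?lee_fin. Qed.
Let wq0 i : (0 <= w i * (q i 0)%:E)%E. Proof. by rewrite mule_ge0 ?lee_fin. Qed.

Lemma weighted_pos_le1 i : (v i * (p i 0)%:E <= 1)%E.
Proof.
apply: le_trans pq1; apply: (@le_trans _ _ (\sum_i v i * (p i 0)%:E)%E).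
  by rewrite (bigD1 i) //=; apply: leeDl; apply: sume_ge0 => *.
by apply: leeDl; apply: sume_ge0 => *.
Qed.

Lemma weighted_neg_le1 i : (w i * (q i 0)%:E <= 1)%E.
Proof.
apply: le_trans pq1; apply: (@le_trans _ _ (\sum_i w i * (q i 0)%:E)%E).
  by rewrite (bigD1 i) //=; apply: leeDl; apply: sume_ge0 => *.
by apply: leeDr; apply: sume_ge0 => *.
Qed.

(** A positive entry would contribute an infinite term to a sum bounded by 1. *)
Lemma weighted_pos_eq0 i : v i \isn't a fin_num -> p i 0 = 0.
Proof.
move=> vi; apply/eqP/negPn/negP => pi; have := weighted_pos_le1 i.
have -> : v i = +oo%E by move: vi (v0 i); case: (v i) => //.
by rewrite gt0_mulye // lte_fin lt_def pi p0.
Qed.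

Lemma weighted_neg_eq0 i : w i \isn't a fin_num -> q i 0 = 0.
Proof.
move=> wi; apply/eqP/negPn/negP => qi; have := weighted_neg_le1 i.
have -> : w i = +oo%E by move: wi (w0 i); case: (w i) => //.
by rewrite gt0_mulye // lte_fin lt_def qi q0.
Qed.

Lemma weighted_rweight : weighted v w p q = (rweight v w p q)%:E.
Proof. by apply: weightedE;
  [exact: weighted_pos_eq0|exact: weighted_neg_eq0]. Qed.

End Terms.

Lemma pos_part_ge0 z i : 0 <= pos_part z i 0.
Proof. by rewrite mxE le_max lexx orbT. Qed.

Lemma neg_part_ge0 z i : 0 <= neg_part z i 0.
Proof. by rewrite mxE le_max lexx orbT. Qed.

Lemma pos_neg_coord z i : z i 0 = pos_part z i 0 - neg_part z i 0.
Proof.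
rewrite !mxE; have [zi|] := boolP (z i 0 <= 0).
  by rewrite (max_r zi) max_l ?oppr_ge0 // opprK add0r.
by rewrite -ltNge => zi; rewrite (max_l (ltW zi)) max_r ?oppr_le0 ?ltW // subr0.
Qed.

Lemma pos_neg_part z : z = pos_part z - neg_part z.
Proof.
by apply/colP => i; rewrite [LHS]pos_neg_coord [RHS]mxE [X in _ = _ + X]mxE.
Qed.

(** * Oracle queries for a sign pattern given in base 3 *)

Definition digit (q i : nat) : nat := (q %/ 3 ^ i) %% 3.

(* Digit 1 allows positive entries, digit 2 negative entries. *)
Definition pat_u (k : nat) : 'cV[R]_n := \col_i (2 * (digit k i)%:R - 3).
Definition pat_v (k : nat) : 'I_n -> \bar R :=
  fun i => if digit k i == 1%N then 1%:E else +oo%E.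
Definition pat_w (k : nat) : 'I_n -> \bar R :=
  fun i => if digit k i == 2%N then 1%:E else +oo%E.

Definition has_pattern (k : nat) h := forall i : 'I_n,
  (0 < h i 0) = (digit k i == 1%N) /\ (h i 0 < 0) = (digit k i == 2%N).

Lemma pat_v_ge0 k i : (0 <= pat_v k i)%E.
Proof. by rewrite /pat_v; case: ifP => _; rewrite ?lee_fin // leey. Qed.

Lemma pat_w_ge0 k i : (0 <= pat_w k i)%E.
Proof. by rewrite /pat_w; case: ifP => _; rewrite ?lee_fin // leey. Qed.

Lemma digit_cases k i : [\/ digit k i = 0, digit k i = 1 | digit k i = 2]%N.
Proof.
have : (digit k i < 3)%N by rewrite ltn_mod.
by case: (digit k i) => [|[|[|]]] // _;
  [constructor 1|constructor 2|constructor 3].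
Qed.

Lemma pat_split_support k p q : (forall i, 0 <= p i 0) -> (forall i, 0 <= q i
  0) ->
    (weighted (pat_v k) (pat_w k) p q <= 1)%E ->
  forall i : 'I_n, (digit k i != 1%N -> p i 0 = 0) /\ (digit k i != 2%N -> q i
    0 = 0).
Proof.
move=> p0 q0 pq i; split=> /negbTE di.
  apply: (weighted_pos_eq0 (pat_v_ge0 k) (pat_w_ge0 k) p0 q0 pq).
  by rewrite /pat_v di.
apply: (weighted_neg_eq0 (pat_v_ge0 k) (pat_w_ge0 k) p0 q0 pq).
by rewrite /pat_w di.
Qed.

(** Digits 1 and 2 have costs -1 and 1, and entries of digit 0 vanish, so the cost of a feasible
    point is minus its weight. *)
Lemma pat_bounded A k : ratio_bounded A (pat_u k) (pat_v k) (pat_w k).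
Proof.
exists (-1) => z [_ zw].
have supp_z := pat_split_support (pos_part_ge0 z) (neg_part_ge0 z) zw.
have := zw; rewrite (weighted_rweight (pat_v_ge0 k) (pat_w_ge0 k)
  (pos_part_ge0 z) (neg_part_ge0 z) zw) lee_fin => zr.
suff : - rweight (pat_v k) (pat_w k) (pos_part z) (neg_part z) <= dot (pat_u k)
  z by lra.
rewrite /rweight /dot -big_split -sumrN; apply: ler_sum => i _ /=.
have [] := supp_z i; rewrite (pos_neg_coord z i) [pat_u k i 0]mxE /pat_v /pat_w.
case: (digit_cases k i) => -> /= h1 h2.
- by rewrite h1 // h2 //; lra.
- by rewrite h2 //; lra.
- by rewrite h1 //; lra.
Qed.

Section Answer.
Variables (A : 'M[R]_(m, n)) (k : nat) (z : 'cV[R]_n).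
Hypothesis zopt : ratio_basic_optimal A (pat_u k) (pat_v k) (pat_w k) z.

(** Splitting by the digits rather than by the signs of [e] makes [split_pos], [split_neg] and
    [omega] linear, and still gives the positive and negative parts for a vector of the pattern. *)
Let split_pos (e : 'cV[R]_n) : 'cV[R]_n := \col_i (if digit k i == 1%N then e i
  0 else 0).
Let split_neg (e : 'cV[R]_n) : 'cV[R]_n := \col_i (if digit k i == 2%N then - e
  i 0 else 0).
Let omega e := rweight (pat_v k) (pat_w k) (split_pos e) (split_neg e).

Lemma pat_answer_ker : A *m z = 0.
Proof. by have [p [q [-> [Apq _ _] _ _]]] := zopt; rewrite mulmxBr. Qed.

Lemma pat_answer_signs (i : 'I_n) : [/\ digit k i = 0%N -> z i 0 = 0,
  digit k i = 1%N -> 0 <= z i 0 & digit k i = 2%N -> z i 0 <= 0].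
Proof.
have [p [q [-> [_ pq pq0] _ _]]] := zopt.
have p0 j : 0 <= p j 0 by case: (pq0 j).
have q0 j : 0 <= q j 0 by case: (pq0 j).
have [h1 h2] := pat_split_support p0 q0 pq i.
rewrite !mxE; split=> di.
- by rewrite h1 ?h2 ?di // subrr.
- by rewrite h2 ?di // subr0.
- by rewrite h1 ?di // sub0r oppr_le0.
Qed.

Lemma split_sub (e : 'cV[R]_n) : (forall i, z i 0 = 0 -> e i 0 = 0) ->
  e = split_pos e - split_neg e.
Proof.
move=> ez; apply/colP => i; rewrite !mxE.
have [z0 _ _] := pat_answer_signs i.
by case: (digit_cases k i) => di; rewrite di /= ?opprK ?subr0 ?add0r // ez ?z0.
Qed.

(** The vector [e] lifts to a kernel vector of the split matrix with slack entry [- omega e]. The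
    disjunction ensures that this entry is 0 or that the slack [1 - omega z] belongs to the
    support. *)
Lemma pat_answer_basic (e : 'cV[R]_n) : A *m e = 0 ->
  (forall i, z i 0 = 0 -> e i 0 = 0) -> omega e = 0 \/ omega z != 1 -> e = 0.
Proof.
move=> Ae ez oe; have [p [q [zE [_ pq pq0] bas _]]] := zopt.
have p0 j : 0 <= p j 0 by case: (pq0 j).
have q0 j : 0 <= q j 0 by case: (pq0 j).
have supp_pq := pat_split_support p0 q0 pq.
have pE : split_pos z = p.
  apply/colP => i; rewrite mxE zE !mxE; have [h1 h2] := supp_pq i.
  by case: ifP => [/eqP di|/negbT/h1 //]; rewrite h2 ?subr0 // di.
have qE : split_neg z = q.
  apply/colP => i; rewrite mxE zE !mxE; have [h1 h2] := supp_pq i.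
  by case: ifP => [/eqP di|/negbT/h2 //]; rewrite h1 ?sub0r ?opprK // di.
have oz : fine (weighted (pat_v k) (pat_w k) p q) = omega z.
  by rewrite (weighted_rweight (pat_v_ge0 k) (pat_w_ge0 k) p0 q0 pq) /= /omega
    pE qE.
have eE := split_sub ez.
pose d : 'cV[R]_(n + n + 1) :=
  col_mx (col_mx (split_pos e) (split_neg e)) (- omega e)%:M.
have d0 : d = 0.
  apply: bas.
  - rewrite /split_matrix /d mul_block_col mul0mx addr0 mul_row_col mulNmx.
    rewrite -mulmxBr -eE Ae mul_row_col mul1mx -[RHS](@vsubmxK _ m 1) !linear0.
    congr col_mx; apply/matrixP => i j; rewrite !ord1 !mxE eqxx mulr1n.
    by rewrite /omega /rweight; apply/eqP; rewrite subr_eq0; apply/eqP;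
      congr (_ + _); apply: eq_bigr => l _; rewrite !mxE.
  - apply/fintype.subsetP => l; rewrite !in_supp; apply: contraNN => /eqP.
    rewrite /d /split_point oz; case: (@split_ordP (n + n) 1 l) => l' ->;
      last first.
      rewrite !(ord1 l') !col_mxEd !mxE eqxx !mulr1n.
      by case: oe => [->|oe] oz1; [rewrite oppr0|case/eqP: oe; lra].
    rewrite !col_mxEu; case: (@split_ordP n n l') => l'' ->.
      rewrite !col_mxEu -pE !mxE; case: ifP => // di pl.
      by rewrite ez.
    rewrite !col_mxEd -qE !mxE; case: ifP => // di pl.
    by rewrite ez ?oppr0 //; apply: oppr_inj; rewrite oppr0.
have d1 : col_mx (split_pos e) (split_neg e) = 0.
  by rewrite -[LHS](@col_mxKu _ _ 1 _ _ (- omega e)%:M) -/d d0 linear0.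
have sp0 : split_pos e = 0.
  by rewrite -(col_mxKu (split_pos e) (split_neg e)) d1 linear0.
have sn0 : split_neg e = 0.
  by rewrite -(col_mxKd (split_pos e) (split_neg e)) d1 linear0.
by rewrite eE sp0 sn0 subrr.
Qed.

(** When the weight constraint is tight, [omega] is cancelled by subtracting a multiple of [z] from
    the competitor [h]; basicness then makes [h] proportional to [z], so its support is not
    smaller. *)
Lemma pat_answer_elementary : z != 0 -> elementary A z.
Proof.
move=> z0; have Az := pat_answer_ker; split=> // h Ah h0; apply/negP => hz.
have hz0 i : z i 0 = 0 -> h i 0 = 0.
  move/properP: hz => [/fintype.subsetP/(_ i) + _]; rewrite !in_supp => hi zi.
  by apply/eqP/negPn/negP => /hi; rewrite zi eqxx.
have [oz|oz] := eqVneq (omega z) 1; last first.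
  by move/eqP: h0; apply; apply: pat_answer_basic; [| |right].
have omegaB a : omega (h - a *: z) = omega h - a * omega z.
  rewrite /omega /rweight mulrDr !mulr_sumr opprD addrACA -!sumrB.
  congr (_ + _); apply: eq_bigr => i _; rewrite !mxE; case: ifP => _; ring.
have : h - omega h *: z = 0.
  apply: pat_answer_basic.
  - by rewrite mulmxBr -scalemxAr Ah Az scaler0 subrr.
  - by move=> i zi; rewrite !mxE hz0 // zi mulr0 subrr.
  - by left; rewrite omegaB oz mulr1 subrr.
move/eqP; rewrite subr_eq0 => /eqP hE; move: h0 hz;
  rewrite hE scaler_eq0 negb_or.
by move=> /andP[a0 _]; rewrite suppZ // fintype.properxx.
Qed.

(** A scaled copy of [h] is feasible with negative cost, so the answer is nonzero. Its support lies
    in that of [h], hence it is a multiple of [h], and the pattern makes the factor positive. *)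
Lemma pat_answer_multiple h : elementary A h -> has_pattern k h ->
  exists2 a, 0 < a & z = a *: h.
Proof.
move=> hE hk; have [Ah h0 _] := hE.
have zh i : h i 0 = 0 -> z i 0 = 0.
  move=> hi; have [k1 k2] := hk i; have [z0 _ _] := pat_answer_signs i.
  by move: k1 k2; rewrite hi ltxx; case: (digit_cases k i) => di;
    rewrite di // z0.
have [i zi] : exists i : 'I_n, z i 0 != 0.
  apply: neq0_coord; apply/negP => /eqP z0.
  have hE' : h = split_pos h - split_neg h.
    apply/colP => i; rewrite !mxE; have := hk i.
    case: (digit_cases k i) => di; rewrite di /= ?opprK ?subr0 ?add0r //.
    by case: ltgtP => // ? [] // _.
  have sp0 i : 0 <= split_pos h i 0.
    by rewrite mxE -(hk i).1; case: ifP => // /ltW.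
  have sn0 i : 0 <= split_neg h i 0.
    by rewrite mxE -(hk i).2; case: ifP => // /ltW; rewrite oppr_ge0.
  have [p [q [zE _ _ opt]]] := zopt.
  have W0 := rweight_ge0 (pat_v_ge0 k) (pat_w_ge0 k) sp0 sn0.
  set W := rweight _ _ _ _ in W0.
  (* This scaling brings the weight [W] of [h] to at most 1. *)
  pose t := (W + 1)^-1; have t0 : 0 < t by rewrite invr_gt0; lra.
  have := opt (t *: split_pos h) (t *: split_neg h).
  rewrite -!dotB -zE z0 dot0 -scalerBr -hE' dotZ.
  suff uh : dot (pat_u k) h < 0.
    have feas : split_feasible A (pat_v k) (pat_w k) (t *: split_pos h) (t *:
      split_neg h).
      split=> [||i].
      - by rewrite -mulmxBr -scalerBr -hE' -scalemxAr Ah scaler0.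
      - rewrite weightedE => [|i|i]; first last.
        + by rewrite /pat_w !mxE; case: ifP => // _ _; rewrite mulr0.
        + by rewrite /pat_v !mxE; case: ifP => // _ _; rewrite mulr0.
        rewrite rweightZ lee_fin -/W /t mulrC ler_pdivrMr; lra.
      - by split; rewrite mxE; apply: mulr_ge0 => //; exact: ltW.
    by move/(_ feas); nra.
  have [j hj] := neq0_coord h0.
  have term (i' : 'I_n) : pat_u k i' 0 * h i' 0 <= 0 /\ (h i' 0 != 0 -> pat_u k
    i' 0 * h i' 0 < 0).
    have [] := hk i'; rewrite mxE; case: (digit_cases k i') => -> /=.
    - by case: (ltgtP (h i' 0) 0) => // hz _ _; rewrite ?hz mulr0; split=> //;
      rewrite ?eqxx.
    - by move=> hi _; have h1 : 0 < h i' 0 := hi; split=> [|_]; lra.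
    - by move=> _ hi; have h1 : h i' 0 < 0 := hi; split=> [|_]; lra.
  rewrite /dot (bigD1 j) //= ltr_wnDr //; last by case: (term j) => _; apply.
  by apply: sumr_le0 => i _; case: (term i).
have hi : h i 0 != 0 by apply: contraNneq zi => /zh ->.
exists (z i 0 / h i 0); last first.
  apply: elementary_multiple hE pat_answer_ker _ hi.
  by apply/fintype.subsetP => j; rewrite !in_supp;
    apply: contraNN => /eqP/zh ->.
have [_ z1 z2] := pat_answer_signs i; have [k1 k2] := hk i.
move: hi; rewrite neq_lt => /orP[] hi.
  rewrite -divrNN divr_gt0 // oppr_gt0 // lt_neqAle zi z2 //.
  by apply/eqP; rewrite -k2.
by rewrite divr_gt0 // lt_def zi z1 //; apply/eqP; rewrite -k1.
Qed.

End Answer.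

(** * An oracle query that decides optimality *)

Definition test_w x : 'I_n -> \bar R :=
  fun i => if x i 0 == 0 then +oo%E else (x i 0)^-1%:E.

Lemma test_w_ge0 x i : (forall j, 0 <= x j 0) -> (0 <= test_w x i)%E.
Proof. by move=> x0; rewrite /test_w; case: ifP => _;
  rewrite ?leey // lee_fin invr_ge0. Qed.

(** Each term [q i 0 / x i 0] is at most 1, and nothing is subtracted where [x] is 0, so the point
    stays nonnegative. *)
Lemma test_feasible A b x p q : polyhedron A b x ->
  split_feasible A (fun=> 0%E) (test_w x) p q -> polyhedron A b (x + (p - q)).
Proof.
move=> [Ax x0] [Apq pq1 pq0].
have p0 j : 0 <= p j 0 by case: (pq0 j).
have q0 j : 0 <= q j 0 by case: (pq0 j).
have w0 i := test_w_ge0 i x0.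
split=> [|i]; first by rewrite mulmxDr mulmxBr Apq addr0.
have := weighted_neg_le1 (fun=> lexx 0%E) w0 p0 q0 pq1 i.
have := @weighted_neg_eq0 _ _ _ _ (fun=> lexx 0%E) w0 p0 q0 pq1 i.
rewrite !mxE /test_w; have := p0 i; have := x0 i.
case: ifPn => [/eqP -> _ pi /(_ isT) -> _|xi xi0 pi _];
  first by rewrite add0r subr0.
have xi1 : 0 < x i 0 by rewrite lt_def xi.
by rewrite -EFinM lee_fin mulrC ler_pdivrMr // mul1r; lra.
Qed.

Lemma test_bounded A b c x : polyhedron A b x -> has_lbound (lp_values A b c) ->
  ratio_bounded A c (fun=> 0%E) (test_w x).
Proof.
move=> Px [L Lb]; exists (L - dot c x) => z [Az zw].
rewrite lerBlDl -dotD; apply: Lb; exists (x + z) => //.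
rewrite {1}(pos_neg_part z); apply: test_feasible => //; split => //.
  by rewrite -mulmxBr -pos_neg_part.
by move=> i; rewrite pos_part_ge0 neg_part_ge0.
Qed.

Lemma test_correct A b c x z : polyhedron A b x ->
  ratio_basic_optimal A c (fun=> 0%E) (test_w x) z ->
  lp_optimal A b c x <-> 0 <= dot c z.
Proof.
move=> Px [p [q [zE feas _ opt]]];
  split=> [[_ /(_ _ (test_feasible Px feas))]|cz].
  by rewrite -zE dotD; lra.
split=> // y Py; have [[_ x0] [_ y0]] := (Px, Py).
(* Every coordinate of [y - x] uses weight at most 1, so dividing by [n + 1] makes the direction
   towards [y] feasible for the query. *)
pose t : R := (n%:R + 1)^-1.
have n0 : (0 : R) <= n%:R by [].
have t0 : 0 < t by rewrite invr_gt0; lra.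
have := opt (t *: pos_part (y - x)) (t *: neg_part (y - x)).
rewrite -!dotB -zE -scalerBr -pos_neg_part dotZ dotB => le.
suff : split_feasible A (fun=> 0%E) (test_w x) (t *: pos_part (y - x)) (t *:
  neg_part (y - x)).
  by move/le; nra.
split=> [||i].
- by rewrite -mulmxBr -scalerBr -pos_neg_part -scalemxAr (polyhedron_ker Px Py)
  scaler0.
- rewrite /weighted big1 ?add0e => [|i _]; last by rewrite mul0e.
  apply: (@le_trans _ _ (\sum_(i < n) t%:E)%E).
    apply: lee_sum => i _; rewrite !mxE /test_w; have := x0 i; have := y0 i.
    case: ifPn => [/eqP -> y0i _|xi y0i x0i].
      by rewrite subr0 max_r ?oppr_le0 // mulr0 mule0 lee_fin ltW.
    have xi1 : 0 < x i 0 by rewrite lt_def xi.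
    rewrite -EFinM lee_fin mulrC ler_pdivrMr // ler_pM2l // ge_max; lra.
  rewrite sumEFin lee_fin sumr_const card_ord -mulr_natl /t ler_pdivrMr; lra.
- by split; rewrite mxE; apply: mulr_ge0;
  rewrite ?pos_part_ge0 ?neg_part_ge0 // ltW.
Qed.

End Oracle.

(** * Circuit walks encoded by natural numbers *)

Fixpoint code (n : nat) (d : nat -> nat) : nat :=
  if n is n'.+1 then (d 0 + 3 * code n' (d \o S))%N else 0%N.

Lemma digitS q i : digit q i.+1 = digit (q %/ 3) i.
Proof. by rewrite /digit expnS divnMA. Qed.

Lemma code_lt n d : (forall i, (d i < 3)%N) -> (code n d < 3 ^ n)%N.
Proof.
elim: n d => // n IH d d3 /=; rewrite expnS.
by have := d3 0%N; have := IH (d \o S) (fun i => d3 i.+1); lia.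
Qed.

Lemma digit_code n d r i : (forall j, (d j < 3)%N) -> (i < n)%N ->
  digit (code n d + 3 ^ n * r) i = d i.
Proof.
elim: n d i => // n IH d i d3;
  rewrite expnS -mulnA /= -addnA -mulnDr mulnC addnC.
case: i => [|i] ni.
  by rewrite /digit expn0 divn1 modnMDl modn_small.
by rewrite digitS divnMDl // divn_small // addn0 IH // => j; exact: d3.
Qed.

(** The number of base [3 ^ n] digits of [q], that is, of patterns in the encoded walk. *)
Definition codelen (n q : nat) := up_log (3 ^ n) q.+1.

Section Moves.
Context {R : realType} {m n : nat}.
Variables (A : 'M[R]_(m, n)) (b : 'cV[R]_m).
Implicit Types (x y z h : 'cV[R]_n) (q k : nat).

Definition move_to q x x' := exists h alpha, [/\ elementary A h, has_pattern q
  h,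
  max_step A b x h alpha & x' = x + alpha *: h].

(** With [x] as default value, a pattern that admits no circuit with a maximal step leaves the point
    in place. *)
Definition move q x : 'cV[R]_n := xget x [set x' | move_to q x x'].

Lemma max_stepZ x h a alpha : 0 < a -> max_step A b x h alpha ->
  max_step A b x (a *: h) (alpha / a).
Proof.
move=> a0 [Pa amax]; have e : alpha / a * a = alpha by field; rewrite gt_eqF.
split=> [|beta]; first by rewrite scalerA e.
by rewrite scalerA => /amax; rewrite ler_pdivlMr.
Qed.

Lemma max_step_uniq x h alpha beta : max_step A b x h alpha ->
  max_step A b x h beta -> alpha = beta.
Proof. by move=> [P1 m1] [P2 m2]; apply/eqP; rewrite eq_le m1 // m2. Qed.

Lemma pattern_multiple q h h' : elementary A h -> elementary A h' ->
  has_pattern q h -> has_pattern q h' -> exists2 a, 0 < a & h' = a *: h.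
Proof.
move=> hE [Ah' h'0 _] hq h'q; have [_ h0 _] := hE.
have [i hi] := neq0_coord h0; exists (h' i 0 / h i 0).
  have [] := hq i; have [<- <-] := h'q i => e1 e2.
  move: hi; rewrite neq_lt => /orP[] hi; last by rewrite divr_gt0 // -e1.
  by rewrite -divrNN divr_gt0 ?oppr_gt0 // -e2.
apply: (elementary_multiple hE Ah' _ hi).
apply/fintype.subsetP => j; rewrite !in_supp !neq_lt.
by have [-> ->] := hq j; have [-> ->] := h'q j.
Qed.

(** Circuits of one pattern are positive multiples of each other and the step length scales
    inversely, so the end point does not depend on the representative. *)
Lemma moveE q x h alpha : elementary A h -> has_pattern q h ->
  max_step A b x h alpha -> move q x = x + alpha *: h.
Proof.
move=> hE hq ha; rewrite /move;
  case: xgetP => [x' _ /= [h' [alpha' [h'E h'q ha' ->]]]|].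
  have [a a0 h'h] := pattern_multiple hE h'E hq h'q.
  have := max_stepZ a0 ha; rewrite -h'h => ha2.
  rewrite (max_step_uniq ha' ha2) h'h scalerA; congr (_ + _ *: _); field.
  by rewrite gt_eqF.
by move=> /(_ (x + alpha *: h)); case; exists h, alpha.
Qed.

(** Along a nonnegative circuit arbitrarily long steps are feasible, so none is maximal. *)
Lemma move_id q x : (forall h, elementary A h -> has_pattern q h ->
  forall i, 0 <= h i 0) -> polyhedron A b x -> move q x = x.
Proof.
move=> hq [Ax x0]; rewrite /move;
  case: xgetP => // x' _ /= [h [alpha [hE hp [_ amax] _]]].
have h0 := hq h hE hp; have [Ah _ _] := hE.
have := amax (`|alpha| + 1); have le := ler_norm alpha.
have lt : (`|alpha| + 1 <= alpha) = false by apply/negbTE; rewrite -ltNge; lra.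
suff : polyhedron A b (x + (`|alpha| + 1) *: h) by move=> P /(_ P); rewrite lt.
split=> [|i]; first by rewrite mulmxDr -scalemxAr Ah scaler0 addr0.
by rewrite !mxE addr_ge0 // mulr_ge0 // addr_ge0.
Qed.

Lemma move_polyhedron q x : polyhedron A b x -> polyhedron A b (move q x).
Proof.
by move=> Px; rewrite /move;
  case: xgetP => // x' _ /= [h [alpha [_ _ [Pa _] ->]]].
Qed.

(** The code is positive because [h] is nonzero; this matters since code 0 ends a walk. The multiple
    of [3 ^ n] leaves room for the patterns that follow. *)
Lemma pattern_code h r : elementary A h ->
  exists2 k, (0 < k < 3 ^ n)%N & has_pattern (k + 3 ^ n * r) h.
Proof.
move=> [_ h0 _].
pose d i : nat := if insub i is Some i' then
  (if 0 < h i' 0 then 1%N else if h i' 0 < 0 then 2 else 0%N) else 0%N.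
have d3 i : (d i < 3)%N.
  by rewrite /d; case: insubP => // i' _ _; case: ifP => // _; case: ifP.
have hk r' : has_pattern (code n d + 3 ^ n * r') h.
  move=> i; rewrite digit_code // /d.
  case: insubP => [i' _ /val_inj ->|]; last by rewrite ltn_ord.
  by case: (ltgtP (h i 0) 0).
exists (code n d) => //; rewrite code_lt // andbT lt0n; apply/eqP => k0.
have [i hi] := neq0_coord h0; have := hk 0%N i; rewrite k0 muln0 addn0.
by rewrite /digit div0n mod0n /= => -[h1 h2]; move: hi; rewrite neq_lt h1 h2.
Qed.

(** Fuel [q] suffices: dividing a positive code by [3 ^ n > 1] decreases it. *)
Fixpoint endpoint_fuel f q x :=
  if f is f'.+1 then
    if q == 0%N then x else endpoint_fuel f' (q %/ 3 ^ n) (move q x)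
  else x.

Definition endpoint q x := endpoint_fuel q q x.

Hypothesis n0 : (0 < n)%N.

Lemma base_gt1 : (1 < 3 ^ n)%N.
Proof. by rewrite -(expn0 3) ltn_exp2l. Qed.

Lemma endpoint_fuelE f q x : (q <= f)%N -> endpoint_fuel f q x = endpoint q x.
Proof.
rewrite /endpoint; elim/ltn_ind: f q x => -[|f] IH q x qf.
  by move: qf; rewrite leqn0 => /eqP ->.
case: q qf => [|q] qf //=.
have lt : (q.+1 %/ 3 ^ n < q.+1)%N by rewrite ltn_Pdiv // base_gt1.
by rewrite IH ?[RHS]IH //; lia.
Qed.

Lemma endpointS q x : (0 < q)%N -> endpoint q x = endpoint (q %/ 3 ^ n) (move q
  x).
Proof.
case: q => // q _; rewrite {1}/endpoint /= endpoint_fuelE //.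
by have : (q.+1 %/ 3 ^ n < q.+1)%N by rewrite ltn_Pdiv // base_gt1.
Qed.

Lemma endpoint_polyhedron q x : polyhedron A b x -> polyhedron A b (endpoint q
  x).
Proof.
elim/ltn_ind: q x => -[|q] IH x Px //; rewrite endpointS //; apply: IH.
  by rewrite ltn_Pdiv // base_gt1.
exact: move_polyhedron.
Qed.

Lemma walk_code k x x' : walk A b k x x' ->
  exists2 q, (q < (3 ^ n) ^ k)%N & endpoint q x = x'.
Proof.
elim: k x => [|k IH] x /=; first by move=> ->; exists 0%N.
move=> [h [alpha [hE ha /IH[q qk <-]]]].
have [r /andP[r0 rn] hr] := pattern_code q hE.
exists (r + 3 ^ n * q)%N.
  by rewrite expnS; have := leq_mul (leqnn (3 ^ n)) qk; rewrite mulnS; lia.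
rewrite endpointS ?addn_gt0 ?r0 // (moveE hE hr ha).
by rewrite addnC mulnC divnMDl ?expn_gt0 // divn_small // addn0.
Qed.

Lemma codelen_le q k : (q < (3 ^ n) ^ k)%N -> (codelen n q <= k)%N.
Proof. by move=> qk; apply: up_log_min => //; exact: base_gt1. Qed.

Lemma codelen_mono q q' : (q <= q')%N -> (codelen n q <= codelen n q')%N.
Proof. by move=> qq'; apply: leq_up_log. Qed.

Lemma codelenS q : (0 < q)%N -> (codelen n (q %/ 3 ^ n) < codelen n q)%N.
Proof.
move=> q0; have := up_logP q.+1 base_gt1; rewrite -/(codelen n q) => qe.
case e : (codelen n q) qe => [|l] qe; first by move: qe; rewrite expn0; lia.
rewrite ltnS; apply: codelen_le; rewrite ltn_divLR ?expn_gt0 //.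
by rewrite -expnSr.
Qed.

End Moves.

(** * The search program *)

Definition NSucc e := NAdd e (NConst 1).
Definition RNum k := RNat (NConst k).
Definition RCol k e := RCell k e (NConst 0).

Definition For i body := Seq (SetN i (NConst 0))
  (While (TLeN (NSucc (NVar i)) NCols) (Seq body (SetN i (NSucc (NVar i))))).

(* Natural registers: 0 loop counter, 1 rest of the code being decoded,
   2 quotient, 3 the oracle's answer has the full pattern, 4 it has a negative
   entry, 5 the code being tried, 6 that code leads to an optimal point.
   Arrays: 3, 4, 5 weights and costs of a pattern, 6-9 answers of the oracle,
   11 simulated point, 12 weights of the optimality test, 13 zero, 14 scalars.
     *)
Definition divide3 := Seq (SetN 2 (NConst 0))
  (While (TLeN (NConst 3) (NVar 1))
     (Seq (SetN 1 (NSub (NVar 1) (NConst 3))) (SetN 2 (NSucc (NVar 2))))).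

(** Column 1 marks infinite weights. With truncated subtraction, [(r - 1) + (1 - r)] vanishes only
    for digit 1, and [2 - r] only for digit 2. *)
Definition decode_body :=
  Seq divide3
  (Seq (SetR 3 (NVar 0) (NConst 0) (RNum 1))
  (Seq (SetR 3 (NVar 0) (NConst 1)
     (RNat (NAdd (NSub (NVar 1) (NConst 1)) (NSub (NConst 1) (NVar 1)))))
  (Seq (SetR 4 (NVar 0) (NConst 0) (RNum 1))
  (Seq (SetR 4 (NVar 0) (NConst 1) (RNat (NSub (NConst 2) (NVar 1))))
  (Seq (SetR 5 (NVar 0) (NConst 0) (RSub (RMul (RNum 2) (RNat (NVar 1))) (RNum
    3)))
  (SetN 1 (NVar 2))))))).

Definition ratio_bound := RDiv (RCol 11 (NVar 0)) (RSub (RNum 0) (RCol 6 (NVar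
  0))).

(** Equality to 0 is tested through nonnegative products: that of the two marks vanishes exactly for
    a nonzero digit, and a square for a zero entry. Register 4 also tells whether array 14 already
    holds a ratio. *)
Definition check_body :=
  Seq (If (TAnd (TLeR (RMul (RCell 3 (NVar 0) (NConst 1)) (RCell 4 (NVar 0)
    (NConst 1)))
                   (RNum 0))
                (TLeR (RMul (RCol 6 (NVar 0)) (RCol 6 (NVar 0))) (RNum 0)))
         (SetN 3 (NConst 0)) Skip)
      (If (TLeR (RNum 0) (RCol 6 (NVar 0))) Skip
         (Seq (If (TAnd (TLeN (NConst 1) (NVar 4)) (TLeR (RCol 14 (NConst 0))
           ratio_bound))
                 Skip (SetR 14 (NConst 0) (NConst 0) ratio_bound))
              (SetN 4 (NConst 1)))).

(** The action is a parameter, so that simulation and execution run the same decoding and the same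
    checks. *)
Definition step_with act :=
  Seq (For 0 decode_body)
  (Seq (Defs.Ratio 5 3 4 6 7 8 9)
  (Seq (SetN 3 (NConst 1))
  (Seq (SetN 4 (NConst 0))
  (Seq (For 0 check_body)
  (If (TAnd (TLeN (NConst 1) (NVar 3)) (TLeN (NConst 1) (NVar 4))) act
    Skip))))).

Definition move_copy := For 0 (SetR 11 (NVar 0) (NConst 0)
  (RAdd (RCol 11 (NVar 0)) (RMul (RCol 14 (NConst 0)) (RCol 6 (NVar 0))))).

Definition follow act :=
  Seq (For 0 (SetR 11 (NVar 0) (NConst 0) (RCur (NVar 0))))
  (Seq (SetN 1 (NVar 5))
  (While (TLeN (NConst 1) (NVar 1)) (step_with act))).

(** Division by 0 yields 0, so [1 - x / x] is nonzero exactly when [x] is 0, which marks the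
    infinite weights. *)
Definition optimality_test :=
  Seq (For 0 (Seq (SetR 12 (NVar 0) (NConst 0) (RDiv (RNum 1) (RCol 11 (NVar
    0))))
                  (SetR 12 (NVar 0) (NConst 1)
                     (RSub (RNum 1) (RDiv (RCol 11 (NVar 0)) (RCol 11 (NVar
                       0)))))))
  (Seq (Defs.Ratio 2 13 12 6 7 8 9)
  (Seq (SetR 14 (NConst 0) (NConst 0) (RNum 0))
  (Seq (For 0 (SetR 14 (NConst 0) (NConst 0)
         (RAdd (RCol 14 (NConst 0)) (RMul (RCol 2 (NVar 0)) (RCol 6 (NVar
           0))))))
  (If (TLeR (RNum 0) (RCol 14 (NConst 0)))
      (SetN 6 (NConst 1)) (SetN 5 (NSucc (NVar 5))))))).

Definition search :=
  Seq (While (TLeN (NVar 6) (NConst 0)) (Seq (follow move_copy)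
    optimality_test))
      (follow (Seq (Augment 6) move_copy)).

(** * Program logic and correctness of one oracle step *)

Section Hoare.
Context {R : realType} {m n : nat}.
Variables (A : 'M[R]_(m, n)) (b : 'cV[R]_m).
Notation state := (@state R n).
Notation ens := (ensures A b).
Implicit Types (st : state) (Q : state -> Prop).

Lemma ens_conseq p st Q Q' : ens p st Q -> (forall st', Q st' -> Q' st') -> ens
  p st Q'.
Proof.
move=> e; elim: e Q' => {p st Q}.
- by move=> st Q q Q' QQ'; apply: EnsSkip; exact: QQ'.
- by move=> k e st Q q Q' QQ'; apply: EnsSetN; exact: QQ'.
- by move=> k e1 e2 e st Q q Q' QQ'; apply: EnsSetR; exact: QQ'.
- move=> p1 p2 st Q1 Q e1 _ _ IH2 Q' QQ'; apply: EnsSeq e1 _ => st1 q1.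
  exact: IH2 q1 _ QQ'.
- by move=> t p1 p2 st Q _ IH Q' QQ'; apply: EnsIf; exact: IH.
- by move=> t p st Q tf q Q' QQ'; apply: EnsWhileStop => //; exact: QQ'.
- move=> t p st Q1 Q tt e1 _ _ IH2 Q' QQ';
  apply: EnsWhileLoop tt e1 _ => st1 q1.
  exact: IH2 q1 _ QQ'.
- by move=> a e1 e2 ku kd kv st Q q Q' QQ'; apply: EnsSVD => /= U D V /q;
  exact: QQ'.
- move=> ku kv kw kz ky ks kl st Q [vw q] Q' QQ'; apply: EnsRatio;
  split=> // z y s l /q.
  exact: QQ'.
- move=> k st Q alpha [h1 h2 h3 q] Q' QQ';
  apply: (@EnsAugment _ _ _ _ _ _ _ _ alpha).
  by split => //; exact: QQ'.
Qed.

Lemma ens_seq p1 p2 st Q : ens p1 st (fun st1 => ens p2 st1 Q) -> ens (Seq p1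
  p2) st Q.
Proof. by move=> e; apply: EnsSeq e _. Qed.

Lemma ens_while (I : state -> Prop) (mu : state -> nat) t p :
    (forall st, I st -> eval_test m st t ->
       ens p st (fun st' => I st' /\ (mu st' < mu st)%N)) ->
  forall st, I st ->
    ens (While t p) st (fun st' => I st' /\ eval_test m st' t = false).
Proof.
move=> body st; move: {2}(mu st).+1 (ltnSn (mu st)) => k.
elim: k st => // k IH st stk Ist.
have [tt|/negbTE tf] := boolP (eval_test m st t); last exact: EnsWhileStop.
apply: EnsWhileLoop tt (body st Ist tt) _ => st1 [Ist1 lt1].
by apply: IH => //; exact: leq_trans lt1 stk.
Qed.

Lemma ens_for (I : nat -> state -> Prop) i body st :
    I 0%N (set_nat st i 0%N) ->
    (forall k st', (k < n)%N -> nats st' i = k -> I k st' ->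
       ens body st' (fun st2 => nats st2 i = k /\ I k.+1 (set_nat st2 i k.+1)))
         ->
  ens (For i body) st (I n).
Proof.
move=> I0 IS; apply/ens_seq/EnsSetN => /=.
pose J st' := (nats st' i <= n)%N /\ I (nats st' i) st'.
have J0 : J (set_nat st i 0%N) by split; rewrite /= /upd eqxx.
apply: ens_conseq (@ens_while J (fun st' => (n - nats st' i)%N) _ _ _ _ J0) _;
  last first.
  move=> st' [[le Ist']] /= /negbT; rewrite addn1 -ltnNge ltnS => ge.
  by have <- : nats st' i = n by apply/eqP; rewrite eqn_leq le.
move=> st' [le Ist'] /=; rewrite addn1 => lt.
apply/ens_seq; apply: ens_conseq (IS _ st' lt erefl Ist') _ => st2 [e IS2].
by apply: EnsSetN; rewrite /J /= /upd eqxx e addn1; split; [split|lia].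
Qed.

(** A frame condition: only the listed registers and arrays may change. The answers of the oracle
    may only accumulate, so a returned direction remains legal for [Augment]. *)
Definition agree (na aa : seq nat) st st' :=
  [/\ forall k, k \notin na -> nats st' k = nats st k,
      forall k, k \notin aa -> arrays st' k = arrays st k,
      current st' = current st,
      steps st' = steps st &
      {subset returned st <= returned st'}].

Lemma agree_refl na aa st : agree na aa st st.
Proof. by split. Qed.
#[local] Hint Resolve agree_refl : core.

Lemma agree_trans na aa st1 st2 st3 :
  agree na aa st1 st2 -> agree na aa st2 st3 -> agree na aa st1 st3.
Proof.
move=> [h1 h2 h3 h4 h5] [k1 k2 k3 k4 k5]; split; last by move=> z /h5/k5.
- by move=> k kn; rewrite k1 ?h1.
- by move=> k ka; rewrite k2 ?h2.
- by rewrite k3.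
- by rewrite k4.
Qed.

Lemma agree_weaken na aa na' aa' st st' : all (mem na') na -> all (mem aa') aa
  ->
  agree na aa st st' -> agree na' aa' st st'.
Proof.
move=> /allP nn /allP aa1 [h1 h2 h3 h4 h5]; split=> // k kn.
  by apply: h1; apply: contra kn => /nn.
by apply: h2; apply: contra kn => /aa1.
Qed.

Lemma agree_set_nat na aa st st' k v : k \in na -> agree na aa st st' ->
  agree na aa st (set_nat st' k v).
Proof.
move=> kn [h1 h2 h3 h4 h5]; split=> // j jn; rewrite /= /upd;
  case: eqP => [e|_].
  by rewrite e kn in jn.
exact: h1.
Qed.

Lemma agree_set_array na aa st st' k a : k \in aa -> agree na aa st st' ->
  agree na aa st (set_array st' k a).
Proof.
move=> ka [h1 h2 h3 h4 h5]; split=> // j jn; rewrite /= /upd;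
  case: eqP => [e|_].
  by rewrite e ka in jn.
exact: h2.
Qed.

Lemma agree_log na aa st st' z : agree na aa st st' ->
  agree na aa st (log_direction st' z).
Proof. by case=> h1 h2 h3 h4 h5; split=> // y /h5 /=; rewrite in_cons => ->;
  rewrite orbT. Qed.

Ltac solve_agree := repeat first [apply: agree_refl | assumption
  | apply: agree_set_nat; first by [] | apply: agree_set_array; first by []
  | apply: agree_log].

Definition vec k st : 'cV[R]_n := matrix_of n 1 (arrays st k).

Lemma vecE k st i : vec k st i 0 = arrays st k i 0%N.
Proof. by rewrite mxE. Qed.

Lemma array_ofK p r (M : 'M[R]_(p, r)) : matrix_of p r (array_of M) = M.
Proof. by apply/matrixP => i j; rewrite mxE /array_of !valK. Qed.

Lemma divide3_ok st : ens divide3 st (fun st' => [/\ agree [:: 1;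
  2]%N [::] st st',
  nats st' 1 = (nats st 1 %% 3)%N & nats st' 2 = (nats st 1 %/ 3)%N]).
Proof.
apply/ens_seq/EnsSetN => /=.
pose J st' := agree [:: 1; 2]%N [::] st st' /\
  (nats st' 1 + 3 * nats st' 2 = nats st 1)%N.
have J0 : J (set_nat st 2 0%N).
  by split; [apply: agree_set_nat|rewrite /= /upd /= muln0 addn0].
apply: ens_conseq (@ens_while J (fun st' => nats st' 1) _ _ _ _ J0) _;
  last first.
  move=> st' [[ag e]] /= /negbT; rewrite -ltnNge => lt; rewrite -e addnC mulnC.
  by split=> //; rewrite ?modnMDl ?modn_small // divnMDl // divn_small // addn0.
move=> st' [ag e] /= le; apply/ens_seq/EnsSetN/EnsSetN; rewrite /J /= /upd /=.
by split; [split; [solve_agree|lia]|lia].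
Qed.

Definition decoded q k st := forall j, (j < k)%N ->
  [/\ arrays st 3 j 0%N = 1,
      arrays st 3 j 1%N = ((digit q j - 1) + (1 - digit q j))%:R,
      arrays st 4 j 0%N = 1, arrays st 4 j 1%N = (2 - digit q j)%:R &
      arrays st 5 j 0%N = 2 * (digit q j)%:R - 3].

Lemma decode_ok st : ens (For 0 decode_body) st (fun st' =>
  [/\ agree [:: 0; 1; 2]%N [:: 3; 4; 5]%N st st',
      nats st' 1 = (nats st 1 %/ 3 ^ n)%N & decoded (nats st 1) n st']).
Proof.
pose J k st' := [/\ agree [:: 0; 1; 2]%N [:: 3; 4; 5]%N st st',
      nats st' 1 = (nats st 1 %/ 3 ^ k)%N & decoded (nats st 1) k st'].
apply: (@ens_for J); first by split => //;
  [apply: agree_set_nat|rewrite /= divn1].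
move=> k st1 kn ik [ag e1 dec]; apply: ens_seq.
apply: ens_conseq (divide3_ok _) _ => st2 [ag2 r2 d2].
have ik2 : nats st2 0 = k by case: ag2 => -> //.
have ag12 : agree [:: 0; 1; 2]%N [:: 3; 4; 5]%N st st2.
  by apply: agree_trans ag _; apply: agree_weaken ag2.
have arr2 k' : arrays st2 k' = arrays st1 k' by case: ag2 => _ ->.
do 5!apply/ens_seq/EnsSetR; apply: EnsSetN; rewrite /= /upd /=; split=> //;
  split.
- by solve_agree.
- by rewrite /= /upd /= d2 e1 expnSr divnMA.
- move=> j; rewrite ltnS leq_eqVlt => /orP[/eqP ->|jk].
    by rewrite /= /upd /= ik2 !eqxx r2 e1.
  by rewrite /= /upd /= ik2 (ltn_eqF jk) !arr2; exact: dec.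
Qed.

Lemma decoded_u q st : decoded q n st -> vec 5 st = pat_u q.
Proof. by move=> d; apply/colP => i; rewrite vecE mxE;
  case: (d i (ltn_ord i)). Qed.

Lemma decoded_v q st : decoded q n st -> weights_of (arrays st 3) = pat_v q :>
  ('I_n -> _).
Proof.
move=> d; apply/funext => i; rewrite /weights_of /pat_v.
have [-> -> _ _ _] := d i (ltn_ord i); rewrite pnatr_eq0.
by case: (digit_cases q i) => ->.
Qed.

Lemma decoded_w q st : decoded q n st -> weights_of (arrays st 4) = pat_w q :>
  ('I_n -> _).
Proof.
move=> d; apply/funext => i; rewrite /weights_of /pat_w.
have [_ _ -> -> _] := d i (ltn_ord i); rewrite pnatr_eq0.
by case: (digit_cases q i) => ->.
Qed.

Definition checked q k st :=
  [/\ (1 <= nats st 3)%N <-> (forall j, (j < k)%N -> digit q j != 0%N -> arrays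
    st 6 j 0%N != 0),
      (1 <= nats st 4)%N <-> (exists2 j, (j < k)%N & arrays st 6 j 0%N < 0) &
      (1 <= nats st 4)%N ->
        (forall j, (j < k)%N -> arrays st 6 j 0%N < 0 ->
           arrays st 14 0%N 0%N <= arrays st 11 j 0%N / - arrays st 6 j 0%N) /\
        (exists j, [/\ (j < k)%N, arrays st 6 j 0%N < 0 &
           arrays st 14 0%N 0%N = arrays st 11 j 0%N / - arrays st 6 j 0%N])].

Lemma check_ok q st : decoded q n st -> nats st 3 = 1%N -> nats st 4 = 0%N ->
  ens (For 0 check_body) st (fun st' =>
    agree [:: 0; 3; 4]%N [:: 14]%N st st' /\ checked q n st').
Proof.
move=> d r3 r4.
pose J k st' := agree [:: 0; 3; 4]%N [:: 14]%N st st' /\ checked q k st'.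
apply: (@ens_for J).
  split; first exact: agree_set_nat.
  by split; rewrite /= /upd /= ?r3 ?r4; split=> // -[].
move=> k st1 kn ik [ag [c3 c4 c14]].
have [agn aga _ _ _] := ag.
have [v0 v1 w0 w1 _] := d k kn.
pose z := arrays st 6; pose y := arrays st 11.
have a6 : arrays st1 6 = z by rewrite aga.
have a11 : arrays st1 11 = y by rewrite aga.
rewrite a6 a11 in c3 c4 c14.
pose st2 := if (digit q k != 0%N) && (z k 0%N == 0) then set_nat st1 3 0%N else
  st1.
have H2 : [/\ agree [:: 0; 3; 4]%N [:: 14]%N st st2, nats st2 0 = k,
    (1 <= nats st2 3)%N <-> (forall j, (j < k.+1)%N -> digit q j != 0%N -> z j
      0%N != 0),
    nats st2 4 = nats st1 4 & arrays st2 = arrays st1].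
  rewrite /st2; case: ifP => [/andP[dk zk]|/negbT].
    split=> //=; first exact: agree_set_nat.
    by rewrite /upd /=; split=> // /(_ k (ltnSn k) dk); rewrite zk.
  rewrite negb_and negbK => dz; split => //; rewrite c3; split=> h j jk;
    last first.
    by apply: h; exact: ltnW.
  move: jk; rewrite ltnS leq_eqVlt => /orP[/eqP -> dk|jk]; last exact: h.
  by move: dz; rewrite (negbTE dk).
apply: ens_seq; apply: EnsIf.
(* The test detects that the pattern requires a nonzero entry where the answer has 0. *)
have -> : eval_test m st1 (TAnd (TLeR (RMul (RCell 3 (NVar 0) (NConst 1))
      (RCell 4 (NVar 0) (NConst 1))) (RNum 0))
      (TLeR (RMul (RCol 6 (NVar 0)) (RCol 6 (NVar 0))) (RNum 0))) =
    (digit q k != 0%N) && (z k 0%N == 0).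
  rewrite /= ik a6 !aga // v1 w1 -natrM lern0 -expr2; congr (_ && _).
    by case: (digit_cases q k) => ->.
  by rewrite real_exprn_even_le0 ?num_real.
apply: (@ens_conseq _ _ (fun st' => st' = st2)).
  by rewrite /st2; case: ifP => _; [apply: EnsSetN|apply: EnsSkip].
move=> _ ->; have [ag2 ik2 c3' e4 ea] := H2; apply: EnsIf.
rewrite /= ik2 ea a6; have [zk|zk] := leP 0 (z k 0%N).
  apply: EnsSkip; split => //; split; first exact: agree_set_nat.
  split; rewrite /= /upd /= ?ea ?a6 ?a11 //; rewrite e4.
    rewrite c4; split=> -[j jk zj]; first by exists j => //; exact: ltnW.
    exists j => //; move: jk; rewrite ltnS leq_eqVlt => /orP[/eqP e|//].
    by move: zj; rewrite e ltNge zk.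
  move=> /c14[h1 [j [jk zj aj]]]; split; last by exists j; split=> //;
    exact: ltnW.
  move=> i; rewrite ltnS leq_eqVlt => /orP[/eqP ->|ik'];
    first by rewrite ltNge zk.
  exact: h1.
apply: ens_seq; apply: EnsIf; rewrite /= ik2 e4 ea a6 a11 sub0r.
set r := y k 0%N / - z k 0%N.
case: ifP => [/andP[g4 le]|/negbT]; last rewrite negb_and => gt.
  apply/EnsSkip/EnsSetN; split=> //; split; first by solve_agree.
  split; rewrite /= /upd /= ?ea ?a6 ?a11 //.
    by split=> // _; exists k.
  move=> _; have [h1 [j [jk zj aj]]] := c14 g4.
  split; last by exists j; split=> //; exact: ltnW.
  by move=> i; rewrite ltnS leq_eqVlt => /orP[/eqP ->|ik']; last exact: h1.
apply/EnsSetR/EnsSetN; split=> //; split.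
  by solve_agree.
split; rewrite /= /upd /= ?ea ?a6 ?a11 //.
  by split=> // _; exists k.
move=> _; rewrite ik2 sub0r -/r; split; last by exists k.
move=> j; rewrite ltnS leq_eqVlt => /orP[/eqP ->|jk] zj; first by [].
have g4 : (1 <= nats st1 4)%N by apply/c4; exists j.
have [h1 _] := c14 g4; move: gt; rewrite g4 /= -ltNge => gt.
by apply: le_trans (ltW gt) _; exact: h1.
Qed.

Lemma array_ofE p r (M : 'M[R]_(p, r)) (i : 'I_p) (j : 'I_r) : array_of M i j =
  M i j.
Proof. by rewrite /array_of !valK. Qed.

Definition step_nats := [:: 0; 1; 2; 3; 4]%N.
Definition step_arrays := [:: 3; 4; 5; 6; 7; 8; 9; 11; 14]%N.

(** Whatever the oracle answers, the outcome is the deterministic [move]: an accepted answer is a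
    circuit of the full pattern and array 14 holds its maximal step, while a rejected one shows that
    the move is trivial. *)
Lemma ens_step act st Q : polyhedron A b (vec 11 st) ->
    (forall st1 z alpha, agree step_nats step_arrays st st1 ->
       nats st1 1 = (nats st 1 %/ 3 ^ n)%N -> vec 11 st1 = vec 11 st ->
       vec 6 st1 = z -> arrays st1 14 0%N 0%N = alpha ->
       z \in returned st1 -> elementary A z -> max_step A b (vec 11 st) z alpha
         ->
       move A b (nats st 1) (vec 11 st) = vec 11 st + alpha *: z ->
       ens act st1 Q) ->
    (forall st1, agree step_nats step_arrays st st1 ->
       nats st1 1 = (nats st 1 %/ 3 ^ n)%N -> vec 11 st1 = vec 11 st ->
       move A b (nats st 1) (vec 11 st) = vec 11 st -> Q st1) ->
  ens (step_with act) st Q.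
Proof.
set q := nats st 1; set Y := vec 11 st => PY Hact Hskip.
apply: ens_seq; apply: ens_conseq (decode_ok st) _ => st1 [ag1 q1 d1].
rewrite -/q in q1 d1.
apply/ens_seq/EnsRatio;
  rewrite /= -/(vec 5 st1) (decoded_u d1) (decoded_v d1) (decoded_w d1).
split=> [i|z y s l /(_ (pat_bounded A q))[zopt _]];
  first by rewrite pat_v_ge0 pat_w_ge0.
do 2!apply/ens_seq/EnsSetN => /=.
set st3 := set_nat _ _ _.
have ag3 : agree step_nats step_arrays st st3.
  by rewrite /st3; solve_agree; apply: agree_weaken ag1.
have a6 : arrays st3 6 = array_of z by [].
have a11 : arrays st3 11 = arrays st 11.
  by rewrite /st3 /= /upd /=; case: ag1 => _ ->.
have z3 : z \in returned st3 by rewrite /= in_cons eqxx.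
apply: ens_seq; apply: ens_conseq (check_ok (q := q) (st := st3) d1 erefl
  erefl) _.
move=> st4 [ag4 [c3 c4 c14]]; have [agn aga agc ags agr] := ag4.
have ag : agree step_nats step_arrays st st4.
  by apply: agree_trans ag3 _; apply: agree_weaken ag4.
have q4 : nats st4 1 = (q %/ 3 ^ n)%N by rewrite agn.
have v11 : vec 11 st4 = Y by rewrite /vec aga // a11.
have z6 (i : 'I_n) : arrays st4 6 i 0%N = z i 0 by rewrite aga // a6 -array_ofE.
have y11 (i : 'I_n) : arrays st4 11 i 0%N = Y i 0 by rewrite aga // a11 -vecE.
have v6 : vec 6 st4 = z by apply/colP => i; rewrite vecE.
have Az := pat_answer_ker zopt.
have signs := pat_answer_signs zopt.
apply: EnsIf; rewrite /=;
  have [/andP[g3 g4]|ng] := boolP ((1 <= nats st4 3)%N && (1 <= nats st4 4)%N).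
  have full := c3.1 g3; have [amin [j [jn zj aj]]] := c14 g4.
  have zj' : z (Ordinal jn) 0 < 0 by rewrite -z6.
  have zE : elementary A z.
    by apply: pat_answer_elementary zopt _; apply: contraTneq zj' => ->;
      rewrite mxE ltxx.
  have zq : has_pattern q z.
    move=> i; have [s0 s1 s2] := signs i; have := full i (ltn_ord i);
      rewrite z6.
    case: (digit_cases q i) => di; rewrite di /=.
    - by rewrite s0 // ltxx.
    - by move=> /(_ isT); rewrite lt_def s1 // andbT => ->; rewrite ltNge s1.
    - by move=> /(_ isT) z0; rewrite ltNge s2 // lt_neqAle z0 s2.
  have za : max_step A b Y z (arrays st4 14 0%N 0%N).
    apply: (max_step_ratio (k := Ordinal jn)) => //.
      by move=> i zi; rewrite -z6 -y11; apply: amin; rewrite ?z6.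
    by rewrite -z6 -y11.
  apply: (Hact st4 z (arrays st4 14 0%N 0%N)) => //; first exact: agr.
  exact: moveE.
(* A circuit of this pattern with a negative entry would force the answer to be a positive multiple
   of it, and the answer would have been accepted. *)
apply: EnsSkip; apply: Hskip => //; apply: move_id => // h hE hq i.
rewrite leNgt; apply/negP => hi.
have [a a0 zh] := pat_answer_multiple zopt hE hq.
move/negP: ng; apply; apply/andP; split.
  apply/c3 => j jn dj; have hj : h (Ordinal jn) 0 != 0.
    rewrite neq_lt; have [-> ->] := hq (Ordinal jn).
    by move: dj; rewrite -[j]/(nat_of_ord (Ordinal jn));
      case: (digit_cases q (Ordinal jn)) => ->.
  rewrite (z6 (Ordinal jn)) zh mxE; apply: mulf_neq0 => //.
  by rewrite gt_eqF.
by apply/c4; exists (i : nat) => //; rewrite z6 zh mxE pmulr_rlt0.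
Qed.

(** The expression may read the old entry that it is about to overwrite, as an in-place update
    does. *)
Lemma ens_fill a e (f : nat -> R) st :
    (forall k st', (k < n)%N -> nats st' 0 = k -> agree [:: 0]%N [:: a] st st'
      ->
       arrays st' a k 0%N = arrays st a k 0%N -> eval_real m st' e = f k) ->
  ens (For 0 (SetR a (NVar 0) (NConst 0) e)) st (fun st' =>
    agree [:: 0]%N [:: a] st st' /\ vec a st' = \col_i f i).
Proof.
move=> fE; pose J k st' := agree [:: 0]%N [:: a] st st' /\
  forall j, arrays st' a j 0%N = if (j < k)%N then f j else arrays st a j 0%N.
apply: (@ens_conseq _ _ (J n)); last first.
  by move=> st' [ag aE]; split=> //; apply/colP => i;
    rewrite vecE mxE aE ltn_ord.
apply: (@ens_for J); first by split=> //; solve_agree.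
move=> k st1 kn ik [ag aE]; apply: EnsSetR; rewrite /= ik; split=> //; split.
  apply: agree_set_nat => //; apply: agree_set_array => //; exact: mem_head.
move=> j; rewrite /= /upd eqxx; case: eqP => [->|/eqP jk] /=.
  by rewrite ltnSn (fE k) // aE ltnn.
by rewrite aE ltnS [in RHS]leq_eqVlt (negbTE jk).
Qed.

Lemma move_copy_ok st : ens move_copy st (fun st' => agree [:: 0]%N [:: 11]%N
  st st' /\
  vec 11 st' = vec 11 st + arrays st 14 0%N 0%N *: vec 6 st).
Proof.
apply: ens_conseq (ens_fill (f := fun i => arrays st 11 i 0%N +
  arrays st 14 0%N 0%N * arrays st 6 i 0%N) _) _; last first.
  by move=> st' [ag ->]; split=> //; apply/colP => i; rewrite !mxE.
by move=> k st' kn ik [_ aga _ _ _] aE; rewrite /= ik aE !aga.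
Qed.

Lemma load_ok st : ens (For 0 (SetR 11 (NVar 0) (NConst 0) (RCur (NVar 0)))) st
  (fun st' => agree [:: 0]%N [:: 11]%N st st' /\ vec 11 st' = current st).
Proof.
apply: ens_conseq (ens_fill (f := fun i => array_of (current st) i 0%N) _) _;
  last first.
  by move=> st' [ag ->]; split=> //; apply/colP => i; rewrite mxE -array_ofE.
by move=> k st' kn ik [_ _ agc _ _] aE; rewrite /= ik agc.
Qed.

(** * Correctness of simulated walks, executed walks and the search *)

Hypothesis n0 : (0 < n)%N.

(** The end point of the remaining code from the simulated point is invariant, and the code
    decreases to 0. *)
Lemma follow_simulated st : polyhedron A b (current st) ->
  ens (follow move_copy) st (fun st' => agree step_nats step_arrays st st' /\
    vec 11 st' = endpoint A b (nats st 5) (current st)).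
Proof.
move=> Px; apply: ens_seq; apply: ens_conseq (load_ok st) _ => st1 [ag1 v1].
apply/ens_seq/EnsSetN => /=; set st2 := set_nat _ _ _.
have ag2 : agree step_nats step_arrays st st2.
  by apply: agree_set_nat => //; apply: agree_weaken ag1.
pose J st' := [/\ agree step_nats step_arrays st st', polyhedron A b (vec 11
  st') &
  endpoint A b (nats st' 1) (vec 11 st') = endpoint A b (nats st 5) (current
    st)].
have J0 : J st2.
  have v2 : vec 11 st2 = current st := v1.
  have q2 : nats st2 1 = nats st 5 by rewrite /st2 /= /upd /=; case: ag1 => ->.
  by split; rewrite ?v2 ?q2.
apply: ens_conseq (ens_while (I := J) (mu := fun st' => nats st' 1) _ J0) _;
  last first.
  move=> st' [[ag _ e]] /= /negbT; rewrite -ltnNge ltnS leqn0 => /eqP q0.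
  by split=> //; rewrite -e q0.
move=> st3 [ag3 P3 e3] /= q0.
have qlt : (nats st3 1 %/ 3 ^ n < nats st3 1)%N by rewrite ltn_Pdiv // base_gt1.
apply: ens_step => // [st4 z alpha ag4 q4 v4 v6 a14 _ _ ha mv|st4 ag4 q4 v4 mv].
  apply: ens_conseq (move_copy_ok st4) _ => st5 [ag5 v5].
  have q5 : nats st5 1 = nats st4 1 by case: ag5 => ->.
  have v5' : vec 11 st5 = move A b (nats st3 1) (vec 11 st3).
    by rewrite v5 v4 v6 a14 -mv.
  split; last by rewrite q5 q4.
  split; last by rewrite v5' q5 q4 -e3 [RHS]endpointS.
    apply: agree_trans ag3 _; apply: agree_trans ag4 _; exact: agree_weaken ag5.
  by rewrite v5'; exact: move_polyhedron.
split; last by rewrite q4.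
split; [exact: agree_trans ag4|by rewrite v4|].
by rewrite v4 q4 -e3 [RHS]endpointS // mv.
Qed.

(** The copy in array 11 follows the current point. Each pass consumes a digit of the code and makes
    at most one augmentation, so steps made plus remaining digits never increase. *)
Lemma follow_executed st : polyhedron A b (current st) ->
  ens (follow (Seq (Augment 6) move_copy)) st (fun st' =>
    current st' = endpoint A b (nats st 5) (current st) /\
    (steps st' <= steps st + codelen n (nats st 5))%N).
Proof.
move=> Px; apply: ens_seq; apply: ens_conseq (load_ok st) _ => st1 [ag1 v1].
apply/ens_seq/EnsSetN => /=; set st2 := set_nat _ _ _.
pose J st' := [/\ polyhedron A b (current st'), vec 11 st' = current st',
  endpoint A b (nats st' 1) (current st') = endpoint A b (nats st 5) (current
    st) &
  (steps st' + codelen n (nats st' 1) <= steps st + codelen n (nats st 5))%N].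
have J0 : J st2.
  have [agn aga agc ags _] := ag1; rewrite /J /st2 /= /upd /= agn // agc ags.
  by split.
apply: ens_conseq (ens_while (I := J) (mu := fun st' => nats st' 1) _ J0) _;
  last first.
  move=> st' [[_ _ e le]] /= /negbT; rewrite -ltnNge ltnS leqn0 => /eqP q0.
  split; first by rewrite -e q0.
  exact: leq_trans (leq_addr _ _) le.
move=> st3 [P3 v3 e3 le3] /= q0.
have qlt : (nats st3 1 %/ 3 ^ n < nats st3 1)%N by rewrite ltn_Pdiv // base_gt1.
have clt := codelenS n0 q0.
apply: ens_step => [|st4 z alpha ag4 q4 v4 v6 a14 zr zE ha mv|st4 ag4 q4 v4 mv].
- by rewrite v3.
- have [agn aga agc ags _] := ag4.
  apply/ens_seq/(EnsAugment (alpha := alpha)).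
  rewrite /= -/(vec 6 st4) v6; split => //; first by rewrite agc -v3.
  apply: ens_conseq (move_copy_ok _) _ => st5 [[n5 a5 c5 s5 _] v5].
  rewrite /J c5 s5 n5 //= q4 agc ags -v3 -mv; split=> //; split.
  + by apply: move_polyhedron; rewrite v3.
  + by rewrite v5 /vec /= -!/(vec _ _) v4 v6 a14 -mv.
  + by rewrite -e3 v3 [RHS]endpointS.
  + by lia.
- have [agn aga agc ags _] := ag4.
  rewrite /J agc ags q4 v4 v3; split=> //; split => //.
    by rewrite -e3 [RHS]endpointS // -v3 mv.
  by lia.
Qed.

Lemma test_ok c st : polyhedron A b (vec 11 st) -> has_lbound (lp_values A b c)
  ->
    vec 2 st = c -> arrays st 13 = (fun _ _ => 0) ->
  ens optimality_test st (fun st' =>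
    agree [:: 0; 5; 6]%N [:: 6; 7; 8; 9; 12; 14]%N st st' /\
    ([/\ lp_optimal A b c (vec 11 st), nats st' 6 = 1%N & nats st' 5 = nats st
      5] \/
     [/\ ~ lp_optimal A b c (vec 11 st), nats st' 6 = nats st 6 &
         nats st' 5 = (nats st 5).+1])).
Proof.
set Y := vec 11 st => PY bnd v2 a13.
pose NA := [:: 0; 5; 6]%N; pose AA := [:: 6; 7; 8; 9; 12; 14]%N.
pose J k st' := agree [:: 0]%N [:: 12]%N st st' /\ forall j, (j < k)%N ->
  arrays st' 12 j 0%N = 1 / arrays st 11 j 0%N /\
  arrays st' 12 j 1%N = 1 - arrays st 11 j 0%N / arrays st 11 j 0%N.
apply: ens_seq; apply: (@ens_conseq _ _ (J n)).
  apply: (@ens_for J); first by split=> //; solve_agree.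
  move=> k st1 kn ik [ag aE]; apply/ens_seq/EnsSetR/EnsSetR => /=.
  have a11 : arrays st1 11 = arrays st 11 by case: ag => _ ->.
  rewrite /upd /= ik a11; split=> //; split; first by solve_agree.
  move=> j; rewrite ltnS leq_eqVlt /= /upd /= => /orP[/eqP ->|jk];
    first by rewrite eqxx.
  by rewrite (ltn_eqF jk); exact: aE.
move=> st1 [ag1 w1].
have wE : weights_of (arrays st1 12) = test_w Y.
  apply/funext => i; rewrite /weights_of /test_w.
  have [-> ->] := w1 i (ltn_ord i); rewrite -vecE -/Y div1r.
  have [->|y0] := eqVneq (Y i 0) 0; first by rewrite mul0r subr0 oner_eq0.
  by rewrite divff // subrr eqxx.
have vE : weights_of (arrays st1 13) = (fun=> 0%E) :> ('I_n -> _).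
  apply/funext => i; have -> : arrays st1 13 = arrays st 13 by case: ag1 => _
    ->.
  by rewrite a13 /weights_of eqxx.
have uE : vec 2 st1 = c by rewrite -v2 /vec; case: ag1 => _ ->.
apply/ens_seq/EnsRatio; rewrite /= -/(vec 2 st1) uE vE wE.
split=> [i|z y s l /(_ (test_bounded PY bnd))[zopt _]].
  by split=> //; apply: test_w_ge0; case: PY.
apply/ens_seq/EnsSetR => /=; set st2 := set_array _ 14 _.
have ag2 : agree NA AA st st2 by rewrite /st2; solve_agree;
  exact: agree_weaken ag1.
pose I k st' := agree NA AA st st' /\ arrays st' 6 = array_of z /\
  nats st' 5 = nats st 5 /\ nats st' 6 = nats st 6 /\
  arrays st' 14 0%N 0%N = \sum_(0 <= j < k) arrays st 2 j 0%N * array_of z j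
    0%N.
have r5 : nats st1 5 = nats st 5 /\ nats st1 6 = nats st 6.
  by case: ag1 => ag1 _ _ _ _; rewrite !ag1.
apply: ens_seq; apply: (@ens_conseq _ _ (I n)).
  apply: (@ens_for I).
    by split; [solve_agree|rewrite /= /upd /= big_nil; case: r5].
  move=> k st3 kn ik [ag3 [a6 [n5 [n6 a14]]]]; apply: EnsSetR => /=.
  have a2 : arrays st3 2 = arrays st 2 by case: ag3 => _ ->.
  split=> //; split; first by solve_agree.
  by rewrite /= /upd /= a14 a6 a2 ik big_nat_recr.
move=> st3 [ag3 [_ [n5 [n6 a14]]]]; apply: EnsIf => /=.
have -> : arrays st3 14 0%N 0%N = dot c z.
  rewrite a14 big_mkord; apply: eq_bigr => i _.
  by rewrite -v2 vecE -array_ofE.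
have correct := test_correct PY zopt.
case: ifP => [/correct opt|ncz].
  by apply: EnsSetN; split; [solve_agree|left; rewrite /= /upd /=].
apply: EnsSetN; split; first by solve_agree.
right; rewrite /= /upd /= addn1 n5 n6; split=> //.
by move/correct; rewrite ncz.
Qed.

(** The search stops at the latest at the code [N] of the given walk. The code it finds is at most
    [N], so it has no more than [k] digits even if it encodes another walk. *)
Lemma search_ok c x k x' : polyhedron A b x -> has_lbound (lp_values A b c) ->
    walk A b k x x' -> lp_optimal A b c x' ->
  ens search (initial_state A b c x) (fun st =>
    lp_optimal A b c (current st) /\ (steps st <= k)%N).
Proof.
move=> Px bnd wx opt; have [N Nk Nx'] := walk_code n0 wx.
set st0 := initial_state A b c x.
pose J st := [/\ current st = x, steps st = 0%N,
  vec 2 st = c, arrays st 13 = (fun _ _ => 0) &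
  (nats st 5 <= N)%N /\
    ((0 < nats st 6)%N -> lp_optimal A b c (endpoint A b (nats st 5) x))].
have J0 : J st0.
  split=> //; rewrite /vec /= /upd /=; exact: array_ofK.
(* The value 0 is reserved for success, so that setting the flag also decreases the measure. *)
pose mu st := if nats st 6 == 0%N then (N - nats st 5).+1 else 0%N.
apply: ens_seq; apply: ens_conseq (ens_while (I := J) (mu := mu) _ J0) _;
  last first.
  move=> st [[cx sx _ _ [N5 found]]] /= /negbT; rewrite -ltnNge => f.
  apply: ens_conseq (follow_executed _) _; first by rewrite cx.
  move=> st' [-> le]; rewrite cx; split; first exact: found.
  rewrite sx add0n in le; apply: leq_trans le _.
  exact: leq_trans (codelen_mono N5) (codelen_le n0 Nk).
move=> st1 [cx sx v2 a13 [N5 found]] /= f.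
apply: ens_seq; apply: ens_conseq (follow_simulated _) _; first by rewrite cx.
move=> st2 [[n2 a2 c2 s2 _] v11].
have P2 : polyhedron A b (vec 11 st2) by rewrite v11 cx;
  exact: endpoint_polyhedron.
apply: ens_conseq (test_ok (c := c) P2 bnd _ _) _.
- by rewrite -v2 /vec a2.
- by rewrite a2.
move=> st3 [[n3 a3 c3 s3 _] cases].
have f0 : nats st1 6 = 0%N by apply/eqP; rewrite -leqn0.
have inv : [/\ current st3 = x, steps st3 = 0%N, vec 2 st3 = c &
    arrays st3 13 = (fun _ _ => 0)].
  by rewrite c3 c2 s3 s2 /vec !a3 // !a2 // -v2; split.
have [i1 i2 i3 i4] := inv; rewrite v11 cx !n2 // in cases.
rewrite /J /mu f0 eqxx; case: cases => -[optY -> ->].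
  by split=> //; split.
rewrite f0 eqxx; have lt : (nats st1 5 < N)%N.
  rewrite ltn_neqAle N5 andbT; apply/eqP => e; apply: optY.
  by rewrite e Nx'.
by split; [split|lia].
Qed.

End Hoare.

(** * The bound in terms of straight line complexity *)

Lemma SLC_ge1 (R : realType) (eta : R) (phi : R -> R) (g : R) :
  (1 <= SLC eta phi g)%E.
Proof.
by apply/ereal_infP => _ [k [psi [[k0 _] _]] <-]; rewrite lee_fin ler1n.
Qed.

Theorem theorem3 (R : realType) :
  exists (C : R) (algorithm : program), 0 < C /\
    forall (m n : nat) (A : 'M[R]_(m, n)) (b : 'cV[R]_m) (c x : 'cV[R]_n),
      (2 <= n)%N ->
      \rank A = m ->
      polyhedron A b x ->
      has_lbound (lp_values A b c) ->
      (forall g : R, 0 <= g -> bounded_vectors (sublevel A b c g)) ->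
      ensures A b algorithm (initial_state A b c x) (fun st =>
        lp_optimal A b c (current st) /\
        ((steps st)%:R%:E <=
           (C * n%:R ^+ 2 * ln n%:R)%:E *
           \sum_(i < n) SLC (1 / 2) (max_central_path A b c i)
                            (opt_gap A b c x))%E).
Proof.
have ln2 : 0 < ln 2 :> R by rewrite ln_gt0 // ltr1n.
(* Dividing by [ln 2 <= ln n] absorbs the logarithm, and the sum of [n] complexities supplies the
   third factor [n] of [41 n ^ 3]. *)
exists (41 / ln 2), search; split=> [|m n A b c x n2 _ Px bnd _].
  by rewrite divr_gt0.
have [k [x' [kn wx' opt]]] := walk_to_optimal n2 Px bnd.
apply: ens_conseq (search_ok (ltnW n2) Px bnd wx' opt) _ => st [ost stk].
split=> //; set D : R := 41 / ln 2 * n%:R ^+ 2 * ln n%:R.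
have lnn : ln 2 <= ln n%:R :> R by rewrite ler_ln ?posrE ?ltr0n ?ler_nat //
  ltnW.
have q0 : (0 : R) <= 41 / ln 2 * n%:R ^+ 2.
  by apply: mulr_ge0; [apply: divr_ge0 => //; exact: ltW|exact: exprn_ge0].
have D0 : 0 <= D by rewrite mulr_ge0 // (le_trans _ lnn) // ltW.
apply: (@le_trans _ _ (D%:E * n%:R%:E)%E); last first.
  apply: lee_wpmul2l; first by rewrite lee_fin.
  apply: (@le_trans _ _ (\sum_(i < n) 1)%E).
    by rewrite sumEFin lee_fin sumr_const card_ord.
  by apply: lee_sum => i _; exact: SLC_ge1.
rewrite -EFinM lee_fin; apply: (@le_trans _ _ (41 * n ^ 3)%:R).
  by rewrite ler_nat (leq_trans stk).
have -> : (41 * n ^ 3)%:R = 41 / ln 2 * n%:R ^+ 2 * ln 2 * n%:R :> R.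
  by rewrite natrM natrX; field; rewrite gt_eqF.
by rewrite ler_wpM2r // ler_wpM2l.
Qed.
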